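(* Let $\eta=(\eta_1,\dots,\eta_p)$ be a partition of $n$ with $p\ge2$, let $K_\eta$ be the associated complete multipartite graph, and let $\alpha$ be a partition of $n$. Then $$\operatorname{spec} T^\alpha[W(K_\eta)]=\Bigl\{q_\alpha-\sum_{i=1}^p q_{\beta^i}:\ (\beta^1,\dots,\beta^p)\ \text{is }(\alpha,\eta)\text{-admissible}\Bigr\}.$$
   Context: Let $N_k:=\{\eta_1+\cdots+\eta_{k-1}+1,\dots,\eta_1+\cdots+\eta_k\}$; $K_\eta$ is the graph on $\{1,\dots,n\}$ in which $\{i,j\}$ is an edge iff $i,j$ lie in different $N_k$'s. $W(K_\eta):=\sum_{\{i,j\}\in E(K_\eta)}(ij)\in\mathbb C S_n$. $T^\alpha$ is a representative of the irreducible complex representation $[\alpha]$ of $S_n$, extended linearly to $\mathbb C S_n$. For a weak composition (finite sequence of nonnegative integers) $\alpha=(\alpha_1,\alpha_2,\dots)$, $q_\alpha:=\frac12\sum_{i\ge1}\alpha_i(\alpha_i-(2i-1))$. The Young subgroup $S_\eta\cong S_{\eta_1}\times\cdots\times S_{\eta_p}$ consists of permutations preserving each $N_k$; its irreducible representations are $[\beta^1]\otimes\cdots\otimes[\beta^p]$ with $\beta^i\vdash\eta_i$, and $c^\alpha_{\beta^1,\dots,\beta^p}$ denotes the multiplicity of $[\beta^1]\otimes\cdots\otimes[\beta^p]$ in the restriction of $[\alpha]$ to $S_\eta$. A $p$-tuple $(\beta^1,\dots,\beta^p)$ is $(\alpha,\eta)$-admissible if each $\beta^i$ is a partition of $\eta_i$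 and $c^\alpha_{\beta^1,\dots,\beta^p}>0$. *)

(* Defs.v *)
From mathcomp Require Import all_boot all_order all_algebra.
From mathcomp Require Import all_fingroup all_solvable all_field all_character.

Set Implicit Arguments.
Unset Strict Implicit.
Unset Printing Implicit Defensive.

Import Order.TTheory GroupScope GRing.Theory Num.Theory.
Local Open Scope ring_scope.

Definition is_partition_of (n : nat) (la : seq nat) : bool :=
  [&& sorted geq la, 0%N \notin la & sumn la == n].

(* q_la = 1/2 \sum_(i >= 1) la_i (la_i - (2i - 1)); rows are numbered from 0 here. *)
Definition content_q (C : fieldType) (la : seq nat) : C :=
  2^-1 * \sum_(i < size la)
    (nth 0%N la i)%:R * ((nth 0%N la i)%:R - (2 * i + 1)%:R).

Section Specht.

Variables (C : fieldType) (T : finType) (A : {set T}) (la : seq nat).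

(* The tableau of shape la filled row by row with the elements of A, in the
   order of enum A: tab_row x and tab_col x locate the box containing x. *)
Definition tab_row (x : T) : nat := reshape_index la (index x (enum A)).
Definition tab_col (x : T) : nat := reshape_offset la (index x (enum A)).

Definition row_stab : {set {perm T}} :=
  [set s in perm.Sym A | [forall x in A, tab_row (s x) == tab_row x]].
Definition col_stab : {set {perm T}} :=
  [set s in perm.Sym A | [forall x in A, tab_col (s x) == tab_col x]].

(* Elements of the group algebra of G are encoded, as in group_ring C G, by
   #|G| x #|G| matrices, with g in G encoded by regular_repr C G g. *)
Definition young_symmetrizer : 'M[C]_#|perm.Sym A| :=
  \sum_(r in row_stab) \sum_(c in col_stab)
    (-1) ^+ odd_perm c *: regular_repr C (perm.Sym_group A) (r * c)%g.

(* The irreducible representation [la] of the symmetric group of A (when la is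
   a partition of #|A|): the Specht module, realized as the ideal generated by
   the Young symmetrizer in the group algebra. MathComp modules are right
   modules, and s * t is s followed by t. *)
Definition specht_mx : 'M[C]_#|perm.Sym A| :=
  cyclic_mx (regular_repr C (perm.Sym_group A)) (gring_row young_symmetrizer).

Definition specht_repr :
    mx_representation C (perm.Sym_group A) (\rank specht_mx) :=
  submod_repr (cyclic_mx_module (regular_repr C (perm.Sym_group A))
                                (gring_row young_symmetrizer)).

End Specht.

Section TensorFamily.

Variables (C : fieldType) (gT : finGroupType) (G : {group gT}).

Lemma triv_mx_repr : mx_repr G (fun _ : gT => 1%:M : 'M[C]_1).
Proof. by split=> // x y _ _; rewrite mulmx1. Qed.

Definition triv_grepr : representation C G :=
  Representation (MxRepresentation triv_mx_repr).

Definition prod_grepr (r1 r2 : representation C G) : representation C G :=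
  Representation (prod_repr r1 r2).

End TensorFamily.

(* Multiplicity of the irreducible representation rW in rV: the sum (with at
   most one nonzero term) of the multiplicities of the isotypic components of
   rV whose simple constituent has the same isomorphism type as rW. *)
Definition repr_mult (C : closedFieldType) (gT : finGroupType) (G : {group gT})
    (m : nat) (rW : mx_representation C G m)
    (n : nat) (rV : mx_representation C G n) : nat :=
  let iG := DecSocleType (regular_repr C G) in
  (\sum_(M : DecSocleType rV | irr_comp iG (socle_repr M) == irr_comp iG rW)
     socle_mult M)%N.

Section CompleteMultipartite.

Variables (n : nat) (eta : seq nat).

Definition block (k : 'I_(size eta)) : {set 'I_n} :=
  [set i : 'I_n | (sumn (take k eta) <= i < sumn (take k.+1 eta))%N].

Definition multipartite_edge : rel 'I_n := fun i j =>
  [exists k, exists l, [&& k != l, i \in block k & j \in block l]].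

Definition young_subgroup : {group 'S_n} :=
  [group of \bigcap_(k < size eta) 'N(block k | 'P)].

Lemma young_subgroup_sub_Sym : young_subgroup \subset perm.Sym [set: 'I_n].
Proof. by apply/subsetP=> s _; rewrite inE; apply/subsetP=> i; rewrite inE. Qed.

Lemma young_subgroup_sub_pre (k : 'I_(size eta)) :
  young_subgroup \subset restr_perm (block k) @*^-1 perm.Sym (block k).
Proof.
apply/subsetP=> s /bigcapP/(_ k isT) Ns.
by apply/morphpreP; split=> //; rewrite inE restr_perm_on.
Qed.

Variable C : fieldType.

(* [la] as a representation of the Young subgroup through its projection onto
   the factor perm.Sym (block k). *)
Definition factor_repr (k : 'I_(size eta)) (la : seq nat) :
    representation C young_subgroup :=
  Representation
    (subg_repr (morphpre_repr (restr_perm_morphism (block k))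
                              (specht_repr C (block k) la))
               (young_subgroup_sub_pre k)).

Definition outer_tensor (beta : 'I_(size eta) -> seq nat) :
    representation C young_subgroup :=
  \big[@prod_grepr C _ young_subgroup/triv_grepr C young_subgroup]_k
     factor_repr k (beta k).

End CompleteMultipartite.

(* The element W(e) of the group algebra; i < j selects each edge once. *)
Definition W_graph (C : fieldType) (n : nat) (e : rel 'I_n) :
    'M[C]_#|perm.Sym [set: 'I_n]| :=
  \sum_(i < n) \sum_(j < n | (i < j)%N && e i j)
     regular_repr C (perm.Sym_group [set: 'I_n]) (tperm i j).

Definition LR_mult (C : closedFieldType) (n : nat) (eta alpha : seq nat)
    (beta : 'I_(size eta) -> seq nat) : nat :=
  repr_mult (outer_tensor n C beta)
    (subg_repr (specht_repr C [set: 'I_n] alpha)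
               (young_subgroup_sub_Sym n eta)).

Definition admissible (C : closedFieldType) (n : nat) (eta alpha : seq nat)
    (beta : 'I_(size eta) -> seq nat) : Prop :=
  (forall k : 'I_(size eta), is_partition_of (nth 0%N eta k) (beta k)) /\
  (0 < LR_mult C n alpha beta)%N.

(* Main.v *)
Require Import Defs.
From mathcomp Require Import all_boot all_order all_algebra.
From mathcomp Require Import all_fingroup all_solvable all_field all_character.
Import Order.TTheory GroupScope GRing.Theory Num.Theory.
Local Open Scope ring_scope.

Set Implicit Arguments.
Unset Strict Implicit.
Unset Printing Implicit Defensive.

(** The graph element W(K_eta) is the sum of all transpositions of S_n minus, for
    each block, the sum of the transpositions of that block. A sum of all
    transpositions of a symmetric group is central and acts on the Specht module
    [la] by the sum q_la of the contents of la: if Y = a b is the Young symmetrizer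
    then a t b is Y, - Y or 0 according as the transposition t preserves the rows,
    preserves the columns, or neither. Hence W(K_eta) acts as
    q_alpha - \sum_k q_(beta^k) on every S_eta-constituent of [alpha] of type
    [beta^1] x ... x [beta^p], and it remains to see that every irreducible
    representation M of S_eta is such an outer tensor product.

    For a symmetric group, the central elements E_la = \sum_g g^-1 Y_la g are
    nonzero multiples of orthogonal idempotents (von Neumann's lemma and the
    dominance order), and cycle types show that they are numerous enough to span
    the centre. So 1 is a combination of the E_la, and therefore some product
    Y = Y_(beta^1) ... Y_(beta^p) does not kill M. As Y g Y is a multiple of Y for
    all g in S_eta, only one isomorphism type of irreducibles is not killed by Y,
    and Y acts nontrivially on every isotypic part of the outer tensor product. *)

(** * Tableaux *)

(** [nth] reads 0 past the end, so it could only miss trailing zeros, and these are excluded. *)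
Lemma eq_nth0_nonzero (la mu : seq nat) :
    0%N \notin la -> 0%N \notin mu ->
  (forall i, nth 0%N la i = nth 0%N mu i) -> la = mu.
Proof.
move=> la0 mu0 eqn.
have lesz (s t : seq nat) : 0%N \notin t ->
    (forall i, nth 0%N s i = nth 0%N t i) -> (size t <= size s)%N.
  move=> t0 e; rewrite leqNgt; apply/negP => lt_st.
  by case/negP: t0; rewrite -(nth_default 0%N (leqnn (size s))) e mem_nth.
apply: (@eq_from_nth _ 0%N) => [|i _]; last exact: eqn.
by apply/eqP; rewrite eqn_leq !lesz.
Qed.

Section Tableau.

Variables (T : finType) (A : {set T}) (la : seq nat).
Hypothesis laP : is_partition_of #|A| la.
Local Notation row := (tab_row A la).
Local Notation col := (tab_col A la).

Lemma tab_sumn : sumn la = #|A|.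
Proof. by case/and3P: laP => _ _ /eqP. Qed.

Lemma partition_nth_geq i j : (i <= j)%N -> (nth 0%N la j <= nth 0%N la i)%N.
Proof.
case/and3P: laP => sla _ _ le_ij.
have [lt_j|ge_j] := ltnP j (size la); last by rewrite [nth _ _ j]nth_default.
apply: (sorted_leq_nth (leT := geq)) => //; rewrite ?inE //.
- by move=> y x z /= h1 h2; apply: leq_trans h2 h1.
- exact: leqnn.
exact: leq_ltn_trans lt_j.
Qed.

Lemma tab_index_lt x : x \in A -> (index x (enum A) < sumn la)%N.
Proof. by move=> Ax; rewrite tab_sumn cardE index_mem mem_enum. Qed.

Lemma tab_box x : x \in A -> (col x < nth 0%N la (row x))%N.
Proof. by move=> Ax; apply: reshape_offsetP; apply: tab_index_lt. Qed.

Lemma tab_inj x y : x \in A -> row x = row y -> col x = col y -> x = y.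
Proof.
move=> Ax er ec; have := reshape_indexK la (index x (enum A)).
rewrite -/(row x) -/(col x) er ec reshape_indexK => eqi.
have Ax' : x \in enum A by rewrite mem_enum.
have Ay' : y \in enum A by rewrite -index_mem eqi index_mem.
by rewrite -(nth_index x Ax') -(nth_index x Ay') eqi.
Qed.

Lemma tab_surj i j : (j < nth 0%N la i)%N ->
  exists x, [/\ x \in A, row x = i & col x = j].
Proof.
move=> ltj; have lt_f := flatten_indexP ltj.
have lt_s : (flatten_index la i j < size (enum A))%N by rewrite -cardE -tab_sumn.
have [x0 Ax0] : exists x, x \in enum A.
  by case: (enum A) lt_s => // x s _; exists x; rewrite mem_head.
exists (nth x0 (enum A) (flatten_index la i j)).
have := mem_nth x0 lt_s; rewrite mem_enum => ->.
rewrite /tab_row /tab_col index_uniq ?enum_uniq //.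
by rewrite flatten_indexKl // flatten_indexKr.
Qed.

(** Parts decrease, so a column that reaches some row meets every earlier row. *)
Lemma tab_up x i : x \in A -> (i <= row x)%N ->
  exists y, [/\ y \in A, row y = i & col y = col x].
Proof.
move=> Ax lei; apply: tab_surj; apply: leq_trans (tab_box Ax) _.
exact: partition_nth_geq.
Qed.

Lemma card_tab_row i : #|[set x in A | row x == i]| = nth 0%N la i.
Proof.
have [x0 Ax0|A0] := pickP (mem A); last first.
  rewrite (eq_card (B := pred0)) ?card0; last by move=> x; rewrite !inE; have /= -> := A0 x.
  apply/esym/eqP; rewrite -leqn0 leqNgt; apply/negP => /tab_surj[x [Ax _ _]].
  by have := A0 x; rewrite /= Ax.
have inA j : (j < nth 0%N la i)%N -> {x | [/\ x \in A, row x = i & col x = j]}.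
  move=> /tab_surj h.
  have h' : exists x, [&& x \in A, row x == i & col x == j].
    by case: h => x [Ax rx cx]; exists x; rewrite Ax rx cx !eqxx.
  by exists (xchoose h'); case/and3P: (xchooseP h') => ? /eqP ? /eqP ?.
pose f (j : 'I_(nth 0%N la i)) := sval (inA j (ltn_ord j)).
have fP j : [/\ f j \in A, row (f j) = i & col (f j) = j].
  exact: (svalP (inA j (ltn_ord j))).
have injf : injective f.
  by move=> j k e; apply: ord_inj; case: (fP j) (fP k) => _ _ <- [_ _ <-]; rewrite e.
rewrite -[RHS]card_ord -(card_codom injf); apply: eq_card => x.
apply/idP/codomP => [|[j ->]]; last by case: (fP j) => fA fr _; rewrite inE fA fr eqxx.
rewrite inE => /andP[Ax /eqP rx].
have ltc : (col x < nth 0%N la i)%N by rewrite -rx tab_box.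
exists (Ordinal ltc); case: (fP (Ordinal ltc)) => fA fr fc.
by apply: tab_inj; rewrite ?rx ?fr ?fc.
Qed.

Lemma tab_col_lt x : x \in A -> (col x < #|A|)%N.
Proof.
move=> Ax; rewrite -tab_sumn; apply: leq_ltn_trans (tab_index_lt Ax).
exact: leq_subr.
Qed.

Variable row' : T -> nat.
Hypothesis sep : forall x y,
  x \in A -> y \in A -> col x = col y -> row' x = row' y -> x = y.

Local Notation cell r k j :=
  #|[set x in A | (r x < k)%N && (col x == j)]|.

(** [sep] makes [row'] injective on column [j], so the left count is at most [k]. If the column
    reaches row [k], its first [k] boxes make the right count at least [k]; otherwise the right
    count is the whole column. *)
Lemma leq_card_sep_col k j : (cell row' k j <= cell row k j)%N.
Proof.
have [/existsP[x /and3P[Ax kx /eqP cx]]|] :=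
    boolP [exists x, [&& x \in A, (k <= row x)%N & col x == j]].
  apply: (@leq_trans k).
    rewrite -[k in X in (_ <= X)%N]card_ord.
    (* The target is ['I_k.+1] so that [inord] makes sense even for [k = 0]. *)
    have injr : {in [set x in A | (row' x < k)%N && (col x == j)] &,
        injective (fun x => inord (row' x) : 'I_k.+1)}.
      move=> y z; rewrite !inE => /and3P[Ay ky /eqP cy] /and3P[Az kz /eqP cz] e.
      apply: sep => //; first by rewrite cy.
      by rewrite -[RHS](@inordK k) -?e ?inordK // ltnW // ltnS ltnW.
    rewrite -(card_in_imset injr).
    have sz : #|[set i : 'I_k.+1 | (i < k)%N]| = k.
      rewrite cardsE -sum1_card -(big_ord_widen_cond k.+1 predT (fun=> 1%N)) //.
      by rewrite sum1_card card_ord.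
    rewrite card_ord -[k in X in (_ <= X)%N]sz; apply: subset_leq_card.
    apply/subsetP => i /imsetP[y]; rewrite !inE => /and3P[_ ky _] ->.
    by rewrite inordK // ltnW.
  pose P y i := [&& y \in A, row y == i & col y == j].
  have ex (i : 'I_k) : exists y, P y i.
    have [//||y [Ay ry cy]] := @tab_up x i _; first exact: leq_trans (ltnW (ltn_ord i)) kx.
    by exists y; rewrite /P Ay ry cy cx !eqxx.
  pose f (i : 'I_k) := xchoose (ex i).
  have fP i : P (f i) i := xchooseP (ex i).
  have injf : injective f.
    move=> i i' e; apply: ord_inj.
    by case/and3P: (fP i) (fP i') => _ /eqP<- _ /and3P[_ /eqP<- _]; rewrite e.
  rewrite -{1}[k]card_ord -(card_codom injf); apply: subset_leq_card.
  apply/subsetP => _ /codomP[i ->]; case/and3P: (fP i) => fA /eqP fr fc.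
  by rewrite inE fA fr fc ltn_ord.
move=> /existsPn allk; apply: subset_leq_card; apply/subsetP => x.
rewrite !inE => /and3P[Ax _ cx]; rewrite Ax cx andbT /=.
by have := allk x; rewrite Ax cx andbT /= -ltnNge.
Qed.

Lemma card_tab_cols (r : T -> nat) k :
  #|[set x in A | (r x < k)%N]| = (\sum_(j < #|A|.+1) cell r k j)%N.
Proof.
rewrite -sum1_card (partition_big (fun x => inord (col x) : 'I_#|A|.+1) predT) //=.
apply: eq_bigr => j _; rewrite -[RHS]sum1_card; apply: eq_bigl => x.
rewrite !inE -val_eqE /=; case: (boolP (x \in A)) => //= Ax.
by rewrite inordK // ltnS ltnW // tab_col_lt.
Qed.

(** The dominance lemma: when [row'] reads the rows of a tableau of shape mu, the first [k] parts of
    mu sum to at most the first [k] parts of [la]. *)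
Lemma leq_card_sep k :
  (#|[set x in A | (row' x < k)%N]| <= #|[set x in A | (row x < k)%N]|)%N.
Proof. by rewrite !card_tab_cols leq_sum // => j _; apply: leq_card_sep_col. Qed.

(* Equality of the row counts forces equality in [leq_card_sep_col]. *)
Lemma sep_box :
    (forall k, #|[set x in A | (row' x < k)%N]| = #|[set x in A | (row x < k)%N]|) ->
  forall x, x \in A -> exists y, [/\ y \in A, row y = row' x & col y = col x].
Proof.
move=> eqk x Ax.
have eqc k (j : 'I_#|A|.+1) : cell row' k j = cell row k j.
  have /leqif_sum : forall j : 'I_#|A|.+1, predT j ->
      (cell row' k j <= cell row k j ?= iff (cell row' k j == cell row k j))%N.
    by move=> i _; split=> //; apply: leq_card_sep_col.
  case=> _; rewrite -!card_tab_cols eqk eqxx => /esym/forallP/(_ j)/implyP.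
  by move=> /(_ isT) /eqP.
have ltc : (col x < #|A|.+1)%N by rewrite ltnS ltnW // tab_col_lt.
have cellS r k j : cell r k.+1 j =
    (cell r k j + #|[set y in A | (r y == k) && (col y == j)]|)%N.
  rewrite -cardsUI [X in (_ = _ + X)%N](_ : _ = 0%N) ?addn0.
    apply: eq_card => y; rewrite !inE -andb_orr -andb_orl ltnS leq_eqVlt.
    by rewrite orbC.
  apply/eqP; rewrite cards_eq0; apply/eqP/setP => y; rewrite !inE.
  by case: (r y =P k) => [->|_]; rewrite ?ltnn ?(andbF, andFb).
(* The difference of the counts for two consecutive bounds isolates the row [row' x] in the column
   of [x]. *)
have := eqc (row' x).+1 (Ordinal ltc); rewrite !cellS (eqc _ (Ordinal ltc)).
move/addnI => /= e.
have : (0 < #|[set y in A | (row' y == row' x) && (col y == col x)]|)%N.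
  by apply/card_gt0P; exists x; rewrite inE Ax !eqxx.
rewrite e => /card_gt0P[y]; rewrite inE => /and3P[Ay /eqP ry /eqP cy].
by exists y.
Qed.

End Tableau.

(** * Young symmetrizers *)

Section LevelStabilizer.

Variables (T : finType) (A : {set T}) (f : T -> nat).

(** By conversion, [row_stab] and [col_stab] are the instances at [tab_row A la] and
    [tab_col A la]. *)
Definition lev_stab : {set {perm T}} :=
  [set s in perm.Sym A | [forall x in A, f (s x) == f x]].

Lemma lev_stabP s :
  reflect (s \in perm.Sym A /\ {in A, forall x, f (s x) = f x}) (s \in lev_stab).
Proof.
rewrite [X in reflect _ X](in_set _ s).
apply: (iffP andP) => [[sA /forall_inP h]|[sA h]]; split=> //.
  by move=> x /h/eqP.
by apply/forall_inP => x /h ->.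
Qed.

Lemma Sym_closed s x : s \in perm.Sym A -> (s x \in A) = (x \in A).
Proof. by rewrite inE => /perm_closed->. Qed.

Lemma lev_stab_group_set : group_set lev_stab.
Proof.
apply/group_setP; split=> [|s t /lev_stabP[sA sf] /lev_stabP[tA tf]].
  by apply/lev_stabP; split=> [|x _]; rewrite ?group1 ?perm1.
apply/lev_stabP; split=> [|x Ax]; first exact: groupM.
by rewrite permM tf ?sf // Sym_closed.
Qed.
Canonical lev_stab_group := Group lev_stab_group_set.

Lemma lev_stab_sub : lev_stab \subset perm.Sym A.
Proof. by apply/subsetP => s /lev_stabP[]. Qed.

Lemma tperm_Sym x y : x \in A -> y \in A -> tperm x y \in perm.Sym A.
Proof.
move=> Ax Ay; rewrite inE; apply: subset_trans (tperm_on x y) _.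
by apply/subsetP => z; rewrite !inE => /orP[] /eqP->.
Qed.

Lemma tperm_lev_stab x y :
  x \in A -> y \in A -> f x = f y -> tperm x y \in lev_stab.
Proof.
move=> Ax Ay e; apply/lev_stabP; split; first exact: tperm_Sym.
by move=> z _; case: tpermP => [->|->|].
Qed.

End LevelStabilizer.

(** * Subgroup sums weighted by a sign-valued character *)

Section WeightedSum.

Variables (C : fieldType) (gT : finGroupType) (G H : {group gT}).
Variables (n : nat) (rG : mx_representation C G n) (w : gT -> C).
Hypothesis sHG : H \subset G.
Hypothesis wM : {in H &, {morph w : x y / (x * y)%g >-> x * y}}.
Hypothesis wV : {in H, forall x, w x * w x = 1}.

Let S := \sum_(x in H) w x *: rG x.

(** Translation by [h] multiplies the sum by the inverse of [w h], which is [w h] itself by [wV]. *)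
Lemma wsum_mull h : h \in H -> rG h *m S = w h *: S.
Proof.
move=> Hh; rewrite /S [in RHS](reindex_inj (mulgI h)) /= mulmx_sumr scaler_sumr.
rewrite [RHS](eq_bigl (mem H)) => [|x]; last by rewrite groupMl.
apply: eq_bigr => x Hx; rewrite -scalemxAr -repr_mxM ?(subsetP sHG) //.
by rewrite scalerA wM // mulrA wV // mul1r.
Qed.

Lemma wsum_mulr h : h \in H -> S *m rG h = w h *: S.
Proof.
move=> Hh; rewrite /S [in RHS](reindex_inj (mulIg h)) /= mulmx_suml scaler_sumr.
rewrite [RHS](eq_bigl (mem H)) => [|x]; last by rewrite groupMr.
apply: eq_bigr => x Hx; rewrite -scalemxAl -repr_mxM ?(subsetP sHG) //.
by rewrite scalerA wM // mulrCA wV // mulr1.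
Qed.

End WeightedSum.

(** Factor [z] through its column and row bases: the reversed product [M] has the same trace, and
    cancelling the full-rank factors in [z *m z = 0] leaves [M = 0]. *)
Lemma sqr0_mxtrace (F : fieldType) n (z : 'M[F]_n) : z *m z = 0 -> \tr z = 0.
Proof.
move=> zz0; rewrite -(mulmx_base z) mxtrace_mulC.
set M := row_base z *m col_base z.
have /row_freeP[D rD] := row_base_free z; have /row_fullP[E Ec] := col_base_full z.
have h : col_base z *m M *m row_base z = 0.
  by rewrite /M (mulmxA (col_base z)) mulmx_base -mulmxA mulmx_base.
clearbody M.
have : E *m (col_base z *m M *m row_base z) *m D = 0 by rewrite h mulmx0 mul0mx.
rewrite (mulmxA E (_ *m M)) (mulmxA E (col_base z)) Ec mul1mx -mulmxA rD mulmx1.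
by move=> ->; rewrite mxtrace0.
Qed.

(** Up to the factor [#|G|], the trace of a group algebra element is thus its coefficient at the
    identity. *)
Lemma mxtrace_regular_repr (F : fieldType) (gT : finGroupType) (G : {group gT}) g :
  g \in G -> \tr (regular_repr F G g) = (g == 1%g)%:R * #|G|%:R.
Proof.
move=> Gg; rewrite /mxtrace.
have E i : regular_repr F G g i i = (g == 1%g)%:R.
  rewrite !mxE eqxx /= -(inj_eq enum_val_inj) gring_indexK ?groupM ?enum_valP //.
  by rewrite eq_sym -[X in _ == X]mulg1 (inj_eq (mulgI _)).
by under eq_bigr do rewrite E; rewrite sumr_const card_ord mulr_natr.
Qed.

(** * Von Neumann's lemma and the central elements attached to partitions *)

Section Young.

Variables (C : numClosedFieldType) (T : finType) (A : {set T}).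
Local Notation G := (perm.Sym_group A).
Local Notation aG := (regular_repr C G).
Local Notation Y la := (young_symmetrizer C A la).

Definition row_sum (la : seq nat) := \sum_(r in row_stab A la) aG r.
Definition col_sum (la : seq nat) :=
  \sum_(c in col_stab A la) (-1) ^+ odd_perm c *: aG c.

Lemma row_stab_sub la : row_stab A la \subset G.
Proof. exact: lev_stab_sub. Qed.

Lemma col_stab_sub la : col_stab A la \subset G.
Proof. exact: lev_stab_sub. Qed.

Lemma young_symmetrizerE la : Y la = row_sum la *m col_sum la.
Proof.
rewrite mulmx_suml; apply: eq_bigr => r Rr; rewrite mulmx_sumr.
apply: eq_bigr => c Cc; rewrite -scalemxAr repr_mxM //.
  exact: (subsetP (row_stab_sub la)).
exact: (subsetP (col_stab_sub la)).
Qed.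

Lemma row_sum_mulr la r : r \in row_stab A la -> row_sum la *m aG r = row_sum la.
Proof.
have e : row_sum la = \sum_(x in row_stab A la) 1 *: aG x.
  by apply: eq_bigr => x _; rewrite scale1r.
move=> Rr; rewrite e -[RHS]scale1r.
apply: (@wsum_mulr C _ G (lev_stab_group A (tab_row A la)) _ aG (fun=> 1)
  (lev_stab_sub A _) _ _ r Rr) => [x y _ _|x _]; by rewrite mulr1.
Qed.

Lemma row_sum_mull la r : r \in row_stab A la -> aG r *m row_sum la = row_sum la.
Proof.
have e : row_sum la = \sum_(x in row_stab A la) 1 *: aG x.
  by apply: eq_bigr => x _; rewrite scale1r.
move=> Rr; rewrite e -[RHS]scale1r.
apply: (@wsum_mull C _ G (lev_stab_group A (tab_row A la)) _ aG (fun=> 1)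
  (lev_stab_sub A _) _ _ r Rr) => [x y _ _|x _]; by rewrite mulr1.
Qed.

Lemma col_sum_mulr la c : c \in col_stab A la ->
  col_sum la *m aG c = (-1) ^+ odd_perm c *: col_sum la.
Proof.
apply: (@wsum_mulr C _ G (lev_stab_group A (tab_col A la)) _ aG
  (fun c : {perm T} => (-1) ^+ odd_perm c) (lev_stab_sub A _)).
  by move=> x y _ _; rewrite odd_permM signr_addb.
by move=> x _; rewrite -signr_addb addbb.
Qed.

Lemma col_sum_mull la c : c \in col_stab A la ->
  aG c *m col_sum la = (-1) ^+ odd_perm c *: col_sum la.
Proof.
apply: (@wsum_mull C _ G (lev_stab_group A (tab_col A la)) _ aG
  (fun c : {perm T} => (-1) ^+ odd_perm c) (lev_stab_sub A _)).
  by move=> x y _ _; rewrite odd_permM signr_addb.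
by move=> x _; rewrite -signr_addb addbb.
Qed.

Lemma row_sum_gring la : (row_sum la \in group_ring C G)%MS.
Proof.
rewrite linear_sum summx_sub //= => r /(subsetP (row_stab_sub la)).
exact: envelop_mx_id.
Qed.

Lemma col_sum_gring la : (col_sum la \in group_ring C G)%MS.
Proof.
rewrite linear_sum summx_sub //= => c /(subsetP (col_stab_sub la)) Gc.
by rewrite linearZ scalemx_sub //= envelop_mx_id.
Qed.

Lemma young_gring la : (Y la \in group_ring C G)%MS.
Proof. by rewrite young_symmetrizerE envelop_mxM ?row_sum_gring ?col_sum_gring. Qed.

(** The condition of von Neumann's lemma. Its failure yields a transposition of the column
    stabilizer of [la] whose conjugate by [h] lies in the row stabilizer of [mu]. *)
Definition separated la mu (h : {perm T}) := [forall x in A, forall y in A,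
  (tab_col A la x == tab_col A la y) &&
  (tab_row A mu (h x) == tab_row A mu (h y)) ==> (x == y)].

Lemma separatedP la mu (h : {perm T}) : reflect
  (forall x y, x \in A -> y \in A -> tab_col A la x = tab_col A la y ->
     tab_row A mu (h x) = tab_row A mu (h y) -> x = y) (separated la mu h).
Proof.
apply: (iffP forall_inP) => [sep x y Ax Ay cxy rxy|sep x Ax].
  have /forall_inP/(_ y Ay) := sep x Ax.
  by rewrite cxy rxy !eqxx /= => /eqP.
apply/forall_inP => y Ay; apply/implyP => /andP[/eqP cxy /eqP rxy].
by rewrite (sep x y).
Qed.

Lemma not_separated la mu h : ~~ separated la mu h ->
  exists x y, [/\ x \in A, y \in A, x != y, tab_col A la x = tab_col A la y &
     tab_row A mu (h x) = tab_row A mu (h y)].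
Proof.
case/forall_inPn => x Ax /forall_inPn[y Ay]; rewrite negb_imply.
by case/andP => /andP[/eqP ? /eqP ?] ?; exists x, y.
Qed.

Lemma card_Sym_preim (h : {perm T}) (P : pred T) : h \in G ->
  #|[set x in A | P (h x)]| = #|[set x in A | P x]|.
Proof.
move=> Gh; rewrite -[RHS](card_preimset _ (@perm_inj _ h)); apply: eq_card => x.
by rewrite !inE Sym_closed.
Qed.

(** [la] dominates [mu]: this is [leq_card_sep] for the [mu]-row read after [h], and [h] permutes
    [A]. *)
Lemma separated_dom la mu h k : is_partition_of #|A| la -> h \in G ->
    separated la mu h ->
  (#|[set x in A | (tab_row A mu x < k)%N]|
     <= #|[set x in A | (tab_row A la x < k)%N]|)%N.
Proof.
move=> laP Gh /separatedP sep.
rewrite -(card_Sym_preim (fun x => (tab_row A mu x < k)%N) Gh).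
exact: (leq_card_sep (row' := fun x => tab_row A mu (h x)) laP sep).
Qed.

(** Von Neumann's lemma. Let [c] move each [x] within its column to the row of [h x]: [sep_box]
    provides the box and separation makes [c] injective. Then [c^-1 * h] preserves rows. *)
Lemma separated_factor la h : is_partition_of #|A| la -> h \in G ->
    separated la la h ->
  exists c r, [/\ c \in col_stab A la, r \in row_stab A la & h = (c * r)%g].
Proof.
move=> laP Gh /separatedP sep.
have ex x : x \in A -> exists y, [&& y \in A, tab_row A la y == tab_row A la (h x)
    & tab_col A la y == tab_col A la x].
  move=> Ax; have [k|y [Ay ry cy]] := sep_box laP sep _ Ax.
    exact: (card_Sym_preim (fun x => (tab_row A la x < k)%N) Gh).
  by exists y; rewrite Ay ry cy !eqxx.
(* The match on [idP] supplies the membership proof that [ex] requires; off [A] the map is the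
   identity. *)
pose c0 x := if @idP (x \in A) is ReflectT Ax then xchoose (ex x Ax) else x.
have c0A x : x \in A -> [/\ c0 x \in A, tab_row A la (c0 x) = tab_row A la (h x)
    & tab_col A la (c0 x) = tab_col A la x].
  rewrite /c0; case: {-}_ / idP => // Ax _.
  by case/and3P: (xchooseP (ex x Ax)) => ? /eqP ? /eqP ?.
have c0N x : x \notin A -> c0 x = x by rewrite /c0; case: {-}_ / idP => // Ax /negP[].
have c0I : injective c0.
  move=> x y; have [Ax|nAx] := boolP (x \in A); have [Ay|nAy] := boolP (y \in A).
  - case: (c0A x Ax) (c0A y Ay) => _ rx cx [_ ry cy] e.
    by apply: sep => //; [rewrite -cx -cy e | rewrite -rx -ry e].
  - by rewrite (c0N y) // => e; case: (c0A x Ax); rewrite e (negPf nAy).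
  - by rewrite (c0N x) // => e; case: (c0A y Ay); rewrite -e (negPf nAx).
  by rewrite !c0N.
pose c := perm c0I.
have Gc : c \in G.
  rewrite inE; apply/subsetP => x; rewrite inE permE; apply: contraR => nAx.
  by rewrite c0N.
exists c, (c^-1 * h)%g; rewrite mulKVg; split=> //.
  by apply/lev_stabP; split=> // x Ax; rewrite permE; case: (c0A x Ax).
apply/lev_stabP; split=> [|x Ax]; first by rewrite groupM ?groupV.
rewrite permM; set y := (c^-1)%g x.
have Ay : y \in A by rewrite Sym_closed ?groupV.
by have -> : x = c0 y; [rewrite /y -(permE c0I) permKV | case: (c0A y Ay)].
Qed.

Lemma eq_oppmx0 n (M : 'M[C]_n) : M = - M -> M = 0.
Proof.
move/eqP; rewrite -addr_eq0 -mulr2n -scaler_nat scaler_eq0 pnatr_eq0 /=.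
by move/eqP.
Qed.

(** With [t] the transposition given by non-separation, [t * h = h * t ^ h]: the column sum turns
    [t] into -1 while the row sum absorbs [t ^ h], so the product equals its opposite. *)
Lemma col_row_sum0 la mu h : h \in G -> ~~ separated la mu h ->
  col_sum la *m aG h *m row_sum mu = 0.
Proof.
move=> Gh /not_separated[x [y [Ax Ay nxy cxy rxy]]].
have Ct : tperm x y \in col_stab A la by apply: tperm_lev_stab.
have Rt : (tperm x y ^ h)%g \in row_stab A mu.
  by rewrite tpermJ; apply: tperm_lev_stab; rewrite ?Sym_closed.
apply: eq_oppmx0; rewrite -[row_sum mu in LHS](row_sum_mull Rt).
have Gt := subsetP (col_stab_sub la) _ Ct.
have Gth := subsetP (row_stab_sub mu) _ Rt.
rewrite mulmxA -(mulmxA _ (aG h)) -repr_mxM // -conjgC repr_mxM // mulmxA.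
by rewrite (col_sum_mulr Ct) odd_tperm nxy expr1 scaleN1r !mulNmx.
Qed.

(** Here the row sum comes first, so separation concerns the inverse of [h]. The factorization stays
    in the conclusion because the action of a transposition is computed from it. *)
Lemma row_col_sum la h : is_partition_of #|A| la -> h \in G ->
  if separated la la h^-1%g then
    exists c r, [/\ c \in col_stab A la, r \in row_stab A la, h = (r * c)%g &
      row_sum la *m aG h *m col_sum la = (-1) ^+ odd_perm c *: Y la]
  else row_sum la *m aG h *m col_sum la = 0.
Proof.
move=> laP Gh; case: ifPn => [sep|/not_separated].
  have [|c [r [Cc Rr e]]] := separated_factor laP _ sep; first exact: groupVr.
  have Cc' : (c^-1)%g \in col_stab A la by rewrite (groupV (lev_stab_group _ _)).
  have Rr' : (r^-1)%g \in row_stab A la by rewrite (groupV (lev_stab_group _ _)).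
  exists (c^-1)%g, (r^-1)%g; rewrite -invMg -e invgK; split=> //.
  have -> : h = (r^-1 * c^-1)%g by rewrite -invMg -e invgK.
  have Gc := subsetP (col_stab_sub la) _ Cc'.
  have Gr := subsetP (row_stab_sub la) _ Rr'.
  rewrite repr_mxM // mulmxA row_sum_mulr // -mulmxA col_sum_mull //.
  by rewrite -scalemxAr -young_symmetrizerE.
case=> x [y [Ax Ay nxy cxy rxy]].
have Ct : tperm x y \in col_stab A la by apply: tperm_lev_stab.
have Rt : (tperm x y ^ h^-1)%g \in row_stab A la.
  by rewrite tpermJ; apply: tperm_lev_stab; rewrite ?Sym_closed ?groupV.
apply: eq_oppmx0; rewrite -[row_sum la in LHS](row_sum_mulr Rt).
have Gt := subsetP (col_stab_sub la) _ Ct.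
have Gth := subsetP (row_stab_sub la) _ Rt.
have e : ((tperm x y ^ h^-1) * h = h * tperm x y)%g.
  by rewrite conjgE invgK -!mulgA mulVg mulg1.
rewrite -(mulmxA _ _ (aG h)) -repr_mxM // e repr_mxM // !mulmxA -mulmxA.
by rewrite col_sum_mull // odd_tperm nxy expr1 scaleN1r mulmxN.
Qed.

Lemma row_col_sum_line la z : is_partition_of #|A| la ->
    (z \in group_ring C G)%MS ->
  exists s, row_sum la *m z *m col_sum la = s *: Y la.
Proof.
move=> laP /envelop_mxP[w ->].
(* Being a multiple of [Y la] is expressed as inclusion in the row space of its [mxvec], which is
   closed under linear combinations. *)
have key x : x \in G ->
    (mxvec (row_sum la *m aG x *m col_sum la) <= mxvec (Y la))%MS.
  move=> Gx; have := row_col_sum laP Gx.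
  case: ifP => _ => [[c [r [_ _ _ ->]]]|->]; first by rewrite linearZ scalemx_sub.
  by rewrite linear0 sub0mx.
move: (row_sum la) (col_sum la) key => a b key.
suff : (mxvec (a *m (\sum_(x in G) w x *: aG x) *m b) <= mxvec (Y la))%MS.
  by case/sub_rVP => s /(canRL mxvecK) ->; exists s; rewrite linearZ /= mxvecK.
rewrite mulmx_sumr mulmx_suml linear_sum summx_sub //= => x Gx.
by rewrite -scalemxAr -scalemxAl linearZ scalemx_sub //= key.
Qed.

Lemma young_sandwich la g : is_partition_of #|A| la -> g \in G ->
  exists s, Y la *m aG g *m Y la = s *: Y la.
Proof.
move=> laP Gg.
have [|s es] := @row_col_sum_line la (col_sum la *m aG g *m row_sum la) laP.
  by rewrite !envelop_mxM ?col_sum_gring ?row_sum_gring ?envelop_mx_id.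
by exists s; rewrite -es young_symmetrizerE !mulmxA.
Qed.

Lemma row_col_stab_triv la s :
  s \in row_stab A la -> s \in col_stab A la -> s = 1%g.
Proof.
move=> /lev_stabP[sA sr] /lev_stabP[_ sc]; apply/permP => x; rewrite perm1.
have [Ax|nAx] := boolP (x \in A); last by move: sA; rewrite inE => /out_perm->.
by apply: (tab_inj (A := A) (la := la)); rewrite ?Sym_closed ?sr ?sc.
Qed.

(** The coefficient of the identity in [Y la] is 1: [r * c = 1] forces [r = c = 1], since the two
    stabilizers meet trivially. *)
Lemma mxtrace_young la : \tr (Y la) = #|G|%:R.
Proof.
rewrite /young_symmetrizer !raddf_sum /=.
rewrite (bigD1 1%g) ?(group1 (lev_stab_group _ _)) //= raddf_sum /=.
rewrite (bigD1 1%g) ?(group1 (lev_stab_group _ _)) //=.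
rewrite odd_perm1 scale1r mulg1 mxtrace_regular_repr // eqxx mul1r.
rewrite big1 ?addr0 => [|c /andP[Cc nc]]; last first.
  rewrite mul1g linearZ /= mxtrace_regular_repr ?(negPf nc) ?mul0r ?mulr0 //.
  exact: (subsetP (col_stab_sub la)).
rewrite big1 ?addr0 // => r /andP[Rr nr]; rewrite raddf_sum big1 //= => c Cc.
have Gc := subsetP (col_stab_sub la) _ Cc.
have Gr := subsetP (row_stab_sub la) _ Rr.
rewrite linearZ /= mxtrace_regular_repr ?groupM //.
case: eqP => [e|_]; last by rewrite mul0r mulr0.
case/eqP: nr; apply: (@row_col_stab_triv la) => //.
have -> : r = (c^-1)%g by apply/eqP; rewrite eq_mulgV1 invgK e.
by rewrite (groupV (lev_stab_group _ _)).
Qed.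

Lemma card_Sym_neq0 : (#|G|%:R : C) != 0.
Proof. by rewrite pnatr_eq0 -lt0n cardG_gt0. Qed.

(** If the scalar vanished, [Y la] would have square zero, hence trace zero, against
    [mxtrace_young]. *)
Lemma young_sqr la : is_partition_of #|A| la ->
  exists2 s, s != 0 & Y la *m Y la = s *: Y la.
Proof.
move=> laP; have [s] := young_sandwich laP (group1 G).
rewrite repr_mx1 mulmx1 => es; exists s => //.
apply/eqP => s0; move: es; rewrite s0 scale0r => /sqr0_mxtrace.
by rewrite mxtrace_young => /eqP; rewrite (negPf card_Sym_neq0).
Qed.

Lemma young_neq0 la : Y la != 0.
Proof.
apply/eqP => y0; have := mxtrace_young la; rewrite y0 mxtrace0.
by move=> /esym/eqP; rewrite (negPf card_Sym_neq0).
Qed.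

Definition young_central la := \sum_(g in G) aG g^-1%g *m Y la *m aG g.
Local Notation E la := (young_central la).

Lemma young_central_gring la : (E la \in group_ring C G)%MS.
Proof.
rewrite linear_sum summx_sub //= => g Gg.
by rewrite !envelop_mxM ?young_gring ?envelop_mx_id ?groupV.
Qed.

Lemma young_central_comm la g : g \in G -> aG g *m E la = E la *m aG g.
Proof.
move=> Gg; rewrite /young_central mulmx_suml (reindex_inj (mulIg g)) mulmx_sumr /=.
rewrite (eq_bigl (mem G)) => [|x]; last by rewrite groupMr.
apply: eq_bigr => x Gx; rewrite invMg !repr_mxM ?groupV //.
by rewrite !mulmxA -repr_mxM ?groupV // mulgV repr_mx1 mul1mx.
Qed.

Lemma young_central_commG la z : (z \in group_ring C G)%MS ->
  z *m E la = E la *m z.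
Proof.
move=> /envelop_mxP[w ->]; rewrite mulmx_suml mulmx_sumr.
apply: eq_bigr => x Gx.
by rewrite -scalemxAl young_central_comm // -scalemxAr.
Qed.

(** Centrality places [E la] between the row and column sums, so the product lies on the line of
    [Y la]. A zero scalar would give [E la] square zero, but each of its [#|G|] summands has trace
    [#|G|]. *)
Lemma young_mul_central la : is_partition_of #|A| la ->
  exists2 s, s != 0 & Y la *m E la = s *: Y la.
Proof.
move=> laP; have [s] := row_col_sum_line laP (young_central_gring la).
rewrite young_central_commG ?row_sum_gring // -mulmxA -young_symmetrizerE.
rewrite -young_central_commG ?young_gring // => es; exists s => //.
apply/eqP => s0; move: es; rewrite s0 scale0r => YE0.
have : E la *m E la = 0.
  rewrite {1}/young_central mulmx_suml big1 // => g Gg.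
  by rewrite -mulmxA young_central_comm // mulmxA -(mulmxA _ (Y la)) YE0 mulmx0 mul0mx.
move/sqr0_mxtrace; rewrite /young_central raddf_sum /=.
under eq_bigr => g Gg.
  rewrite mxtrace_mulC mulmxA -repr_mxM ?groupV // mulgV repr_mx1 mul1mx.
  rewrite mxtrace_young; over.
rewrite sumr_const -mulrnA => /eqP.
by rewrite pnatr_eq0 muln_eq0 !eqn0Ngt !cardG_gt0.
Qed.

Lemma young_central_sqr la : is_partition_of #|A| la ->
  exists2 s, s != 0 & E la *m E la = s *: E la.
Proof.
move=> /young_mul_central[s s0 es]; exists s => //.
rewrite {1 3}/young_central mulmx_suml scaler_sumr; apply: eq_bigr => g Gg.
rewrite -mulmxA young_central_comm // mulmxA -(mulmxA _ (Y la)) es.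
by rewrite -scalemxAr -scalemxAl.
Qed.

Lemma young_central_neq0 la : is_partition_of #|A| la -> E la != 0.
Proof.
case/young_mul_central=> s s0 es; apply: contraNneq s0 => E0.
move/eqP: es; rewrite E0 mulmx0 eq_sym scaler_eq0 (negPf (young_neq0 la)).
by rewrite orbF.
Qed.

(* Both directions being separated would make the shapes dominate each other. *)
Lemma young_central_orth la mu :
    is_partition_of #|A| la -> is_partition_of #|A| mu -> la != mu ->
  E la *m E mu = 0.
Proof.
(* Each product of conjugates contains a factor [col_sum nu *m aG h *m row_sum ka]. This handles one
   order of the shapes; centrality of [E] gives the other. *)
have half nu ka : (forall h, h \in G -> ~~ separated nu ka h) -> E nu *m E ka = 0.
  move=> nsep; rewrite {1}/young_central mulmx_suml big1 // => g Gg.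
  rewrite -mulmxA young_central_comm // mulmxA -(mulmxA _ (Y nu)).
  suff -> : Y nu *m E ka = 0 by rewrite mulmx0 mul0mx.
  rewrite mulmx_sumr big1 // => h Gh; rewrite !young_symmetrizerE.
  rewrite !mulmxA -(mulmxA _ (col_sum nu)) -(mulmxA _ _ (row_sum ka)).
  by rewrite col_row_sum0 ?nsep ?groupV // mulmx0 !mul0mx.
move=> laP muP nlm.
have [/existsP[h /andP[Gh sh]]|/existsPn nsep] :=
    boolP [exists h, (h \in G) && separated la mu h]; last first.
  by apply: half => h Gh; have := nsep h; rewrite Gh.
have [/existsP[g /andP[Gg sg]]|/existsPn nsep] :=
    boolP [exists h, (h \in G) && separated mu la h]; last first.
  rewrite young_central_commG ?young_central_gring //.
  by apply: half => g Gg; have := nsep g; rewrite Gg.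
case/eqP: nlm.
have eqk k : #|[set x in A | (tab_row A la x < k)%N]|
           = #|[set x in A | (tab_row A mu x < k)%N]|.
  by apply/eqP; rewrite eqn_leq (separated_dom k muP Gg sg) (separated_dom k laP Gh sh).
(* Row lengths are recovered as differences of these cumulative counts. *)
have rowS nu k : #|[set x in A | (tab_row A nu x < k.+1)%N]| =
   (#|[set x in A | (tab_row A nu x < k)%N]| + #|[set x in A | tab_row A nu x == k]|)%N.
  rewrite -cardsUI [X in (_ = _ + X)%N](_ : _ = 0%N) ?addn0.
    by apply: eq_card => y; rewrite !inE -andb_orr ltnS leq_eqVlt orbC.
  apply/eqP; rewrite cards_eq0; apply/eqP/setP => y; rewrite !inE.
  by case: (tab_row A nu y =P k) => [->|_]; rewrite ?ltnn ?andbF.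
apply: eq_nth0_nonzero; [by case/and3P: laP|by case/and3P: muP|move=> i].
rewrite -(card_tab_row laP) -(card_tab_row muP).
by have := eqk i.+1; rewrite !rowS (eqk i) => /addnI.
Qed.

End Young.

(** * Action of the sum of transpositions *)

(** Ordered pairs are summed, so every transposition occurs twice; hence the doubled contents in
    later statements. *)
Definition tperm_sum (C : fieldType) (T : finType) (A : {set T}) (d : nat)
    (rho : {perm T} -> 'M[C]_d) : 'M[C]_d :=
  \sum_(x in A) \sum_(y in A | y != x) rho (tperm x y).

(** Conjugation by [g] permutes the ordered pairs of [A]. Only stability of [A] matters, so this
    serves both for the whole symmetric group and for a block inside a larger group. *)
Lemma tperm_sum_comm (C : fieldType) (T : finType) (A : {set T}) (d : nat)
    (H : {group {perm T}}) (rG : mx_representation C H d) g :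
    perm.Sym A \subset H -> g \in H -> (forall x, (g x \in A) = (x \in A)) ->
  rG g *m tperm_sum A rG = tperm_sum A rG *m rG g.
Proof.
move=> sAH Hg gA; rewrite /tperm_sum mulmx_sumr (reindex_inj (@perm_inj _ g)) /=.
rewrite mulmx_suml; apply: eq_big => [x|x Ax]; first by rewrite gA.
rewrite mulmx_sumr (reindex_inj (@perm_inj _ g)) /= mulmx_suml.
apply: eq_big => [y|y /andP[Ay _]]; first by rewrite gA (inj_eq perm_inj).
rewrite gA in Ax; rewrite gA in Ay.
have e : (g * tperm (g x) (g y) = tperm x y * g)%g by rewrite [RHS]conjgC tpermJ.
have Ht : tperm x y \in H by rewrite (subsetP sAH) ?tperm_Sym.
have Ht' : tperm (g x) (g y) \in H by rewrite (subsetP sAH) ?tperm_Sym ?gA.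
by rewrite -repr_mxM // e repr_mxM.
Qed.

(** * Contents of boxes and the scalar of the sum of transpositions *)

Section Content.

Variables (C : numClosedFieldType) (T : finType) (A : {set T}) (la : seq nat).
Hypothesis laP : is_partition_of #|A| la.
Local Notation G := (perm.Sym_group A).
Local Notation aG := (regular_repr C G).
Local Notation Y := (young_symmetrizer C A la).
Local Notation row := (tab_row A la).
Local Notation col := (tab_col A la).

(** If [x] and [y] share a row or a column, one of the two sums absorbs the transposition, with sign
    -1 for a column. Otherwise a factorization [r * c] of it would make [r x] differ from [x] and
    [y]; then [r (r x)] and [r x] would share row and column, forcing [r x = x]. *)
Lemma row_tperm_col_sum x y : x \in A -> y \in A -> y != x ->
  row_sum C A la *m aG (tperm x y) *m col_sum C A la
    = ((row x == row y)%:R - (col x == col y)%:R) *: Y.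
Proof.
move=> Ax Ay nyx.
have [rxy|nr] := eqVneq (row x) (row y).
  have -> : col x == col y = false.
    by apply: contraNF nyx => /eqP cxy; rewrite (tab_inj Ax rxy cxy).
  rewrite subr0 scale1r row_sum_mulr -?young_symmetrizerE //.
  exact: tperm_lev_stab.
have [cxy|nc] := eqVneq (col x) (col y).
  have Ct : tperm x y \in col_stab A la by apply: tperm_lev_stab.
  rewrite sub0r -mulmxA (col_sum_mull _ Ct) odd_tperm eq_sym nyx expr1.
  by rewrite -scalemxAr -young_symmetrizerE.
rewrite subrr scale0r; have := row_col_sum C laP (tperm_Sym Ax Ay).
case: ifP => // _ [c [r [/lev_stabP[cA cc] /lev_stabP[rA rr] e _]]].
have rzA z : z \in A -> r z \in A by rewrite (Sym_closed z rA).
have colr z : z \in A -> col (r z) = col (tperm x y z).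
  by move=> Az; rewrite e permM cc // rzA.
have zx : r x <> x.
  by move=> rx; case/eqP: nc; rewrite -{1}rx colr // tpermL.
have zy : r x <> y by move=> rx; case/eqP: nr; rewrite -rr // rx.
have tz : tperm x y (r x) = r x by rewrite tpermD //; apply/eqP => /esym.
case: zx; apply: (@perm_inj _ r); apply: (tab_inj (la := la) (A := A)).
- by rewrite !rzA.
- by rewrite rr // rzA.
by rewrite colr ?rzA // tz.
Qed.

Lemma card_tab_above x : x \in A ->
  #|[set y in A | (col y == col x) && (row y < row x)%N]| = row x.
Proof.
move=> Ax; pose P y i := [&& y \in A, row y == i & col y == col x].
have ex (i : 'I_(row x)) : exists y, P y i.
  have [|y [Ay ry cy]] := tab_up laP Ax (i := i); first exact: ltnW.
  by exists y; rewrite /P Ay ry cy !eqxx.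
pose f i := xchoose (ex i); have fP i : P (f i) i := xchooseP (ex i).
have injf : injective f.
  move=> i i' e; apply: ord_inj.
  by case/and3P: (fP i) (fP i') => _ /eqP<- _ /and3P[_ /eqP<- _]; rewrite e.
rewrite -[RHS]card_ord -(card_codom injf); apply: eq_card => y.
apply/idP/codomP => [|[i ->]].
  rewrite inE => /and3P[Ay /eqP cy lt]; exists (Ordinal lt).
  case/and3P: (fP (Ordinal lt)) => fA /eqP fr /eqP fc.
  by apply: (tab_inj (la := la) (A := A)) => //; rewrite ?fr ?fc.
by case/and3P: (fP i) => fA /eqP fr fc; rewrite inE fA fr fc ltn_ord.
Qed.

Lemma sum_tab_row (F : nat -> C) :
  \sum_(x in A) F (row x) = \sum_(i < size la) (nth 0%N la i)%:R * F i.
Proof.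
have rlt x : x \in A -> (row x < size la)%N.
  move=> Ax; rewrite ltnNge; apply/negP => le.
  by have := tab_box laP Ax; rewrite nth_default.
(* The empty shape is separate because [inord] needs a nonempty ordinal type. *)
case E : (size la) => [|m].
  rewrite big_ord0 big1 // => x /rlt; by rewrite E.
rewrite (partition_big (fun x => inord (row x) : 'I_m.+1) predT) //=.
apply: eq_bigr => i _.
have eqP' x : (x \in A) && (inord (row x) == i) = (x \in [set x in A | row x == i]).
  rewrite inE; case: (boolP (x \in A)) => //= Ax.
  by rewrite -val_eqE /= inordK // -E rlt.
rewrite (eq_bigl _ _ eqP') (eq_bigr (fun=> F i)).
  by rewrite sumr_const (card_tab_row laP) mulr_natl.
by move=> x; rewrite inE => /andP[_ /eqP->].
Qed.

(** A box of row [i] has [la_i - 1] companions in its row. Each column pair is charged twice to its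
    lower box, which has [i] boxes above it. The total is the sum of [la_i * (la_i - 1 - 2 * i)]. *)
Lemma sum_content :
  \sum_(x in A) \sum_(y in A | y != x) ((row x == row y)%:R - (col x == col y)%:R)
    = content_q C la *+ 2.
Proof.
have natsum (P : pred T) : \sum_(y in A) (P y)%:R = #|[set y in A | P y]|%:R :> C.
  by rewrite -sum1_card natr_sum big_mkcond [RHS]big_mkcond; apply: eq_bigr => y _;
     rewrite inE; case: (y \in A); case: (P y).
have rowE x : x \in A -> \sum_(y in A | y != x) (row x == row y)%:R
    = (nth 0%N la (row x))%:R - 1 :> C.
  move=> Ax; rewrite -(card_tab_row laP) -natsum [in RHS](bigD1 x) //= eqxx.
  have -> : true%:R = 1 :> C by [].
  by rewrite addrAC subrr add0r; apply: eq_bigr => y _; rewrite eq_sym.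
have colE : \sum_(x in A) \sum_(y in A | y != x) (col x == col y)%:R
    = \sum_(x in A) ((row x)%:R *+ 2) :> C.
  transitivity (\sum_(x in A) \sum_(y in A)
      (((col y == col x) && (row y < row x)%N)%:R
       + ((col x == col y) && (row x < row y)%N)%:R : C)).
    apply: eq_bigr => x Ax; rewrite [RHS](bigD1 x) //= !ltnn !andbF add0r add0r.
    apply: eq_bigr => y /andP[Ay nyx]; rewrite [col y == _]eq_sym.
    have [cxy|] := eqVneq (col x) (col y); last by rewrite addr0.
    rewrite /=; case: ltngtP => [| |rxy]; rewrite ?addr0 ?add0r //.
    by case/eqP: nyx; apply: (tab_inj (la := la) (A := A)).
  under eq_bigr do rewrite big_split /=.
  rewrite big_split /= [X in _ + X]exchange_big /= -big_split /=.
  by apply: eq_bigr => x Ax; rewrite natsum card_tab_above // mulr2n.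
under eq_bigr do rewrite sumrB.
rewrite sumrB colE -sumrB.
under eq_bigr => x Ax do rewrite rowE //.
rewrite (sum_tab_row (fun i => (nth 0%N la i)%:R - 1 - i%:R *+ 2)).
rewrite /content_q -[RHS]mulr_natl mulrA mulfV ?pnatr_eq0 // mul1r.
apply: eq_bigr => i _; congr (_ * _).
have -> : (2 * i + 1)%:R = 1 + i%:R *+ 2 :> C.
  by rewrite natrD natrM mulr_natl addrC.
by rewrite -addrA -opprD.
Qed.

(** Centrality moves the sum between the row and column factors, where [row_tperm_col_sum] applies
    term by term. *)
Lemma young_tperm_sum : Y *m tperm_sum A aG = (content_q C la *+ 2) *: Y.
Proof.
have cen z : (z \in group_ring C G)%MS -> z *m tperm_sum A aG = tperm_sum A aG *m z.
  move=> /envelop_mxP[w ->]; move: (tperm_sum A aG) (@tperm_sum_comm C T A _ G aG).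
  move=> t tC; rewrite mulmx_suml mulmx_sumr; apply: eq_bigr => g Gg.
  by rewrite -scalemxAl -scalemxAr tC // => x; rewrite Sym_closed.
rewrite young_symmetrizerE -mulmxA cen ?col_sum_gring // mulmxA.
have key := row_tperm_col_sum.
rewrite -young_symmetrizerE -sum_content scaler_suml.
move: (row_sum C A la) (col_sum C A la) key => a b key.
rewrite /tperm_sum mulmx_sumr mulmx_suml; apply: eq_bigr => x Ax.
rewrite mulmx_sumr mulmx_suml scaler_suml; apply: eq_bigr => y /andP[Ay nyx].
exact: key.
Qed.

End Content.

(** * Cycle types and completeness *)

Section CycleType.

Variables (T : finType) (A : {set T}).
Local Notation G := (perm.Sym_group A).

(** One orbit per root, fixed points of [s] in [A] included, sorted by decreasing length so that the
    shape is a partition. *)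
Definition cycles_of (s : {perm T}) : seq (seq T) :=
  sort (fun u v => size v <= size u)%N
    [seq fingraph.orbit s x | x <- [seq x <- enum A | froot s x == x]].

Definition cycle_type s := shape (cycles_of s).

Lemma cycles_of_perm s : s \in G -> perm_eq (flatten (cycles_of s)) (enum A).
Proof.
move=> Gs; have sC : connect_sym (frel s) := fconnect_sym (@perm_inj _ s).
apply: perm_trans (perm_flatten (permEl (perm_sort _ _))) _.
apply/allP => y _ /=; apply/eqP.
rewrite count_flatten -map_comp (count_uniq_mem _ (enum_uniq _)) mem_enum.
have rootA : (froot s y \in A) = (y \in A).
  have/(fconnect_invariant (f := s) (k := mem A)) inv : invariant s (mem A) =1 xpredT.
    by move=> x; rewrite /= Sym_closed // eqxx.
  by have /= := inv _ _ (connect_root (frel s) y) => ->.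
transitivity (count (pred1 (froot s y)) [seq x <- enum A | froot s x == x]).
  rewrite -sumn_count; congr sumn; apply/eq_in_map => x.
  rewrite mem_filter => /andP[/eqP rx _] /=.
  rewrite count_uniq_mem ?orbit_uniq // -fconnect_orbit -(root_connect sC).
  by rewrite -/(froot s x) -/(froot s y) rx.
rewrite (count_uniq_mem _ (filter_uniq _ (enum_uniq _))) mem_filter mem_enum rootA.
by rewrite (root_root sC) eqxx.
Qed.

Lemma cycles_of_cycle (s : {perm T}) : all (fcycle s) (cycles_of s).
Proof.
rewrite all_sort; apply/allP => _ /mapP[x _ ->].
by apply: cycle_orbit; apply: perm_inj.
Qed.

Lemma cycle_type_partition s : s \in G -> is_partition_of #|A| (cycle_type s).
Proof.
move=> Gs; apply/and3P; split.
- rewrite /cycle_type /shape sorted_map; apply: sort_sorted => u v.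
  exact: leq_total.
- apply/negP => /mapP[u]; rewrite mem_sort => /mapP[x _ ->].
  by rewrite size_orbit => e; have := fingraph.order_gt0 s x; rewrite -e.
by rewrite -size_flatten (perm_size (cycles_of_perm Gs)) cardE.
Qed.

Lemma fcycle_nth (s : T -> T) u x o : fcycle s u -> (o < size u)%N ->
  s (nth x u o) = nth x u (if (o.+1 < size u)%N then o.+1 else 0%N).
Proof.
case: u => // a u /(pathP x) h lt_o.
have := h o; rewrite size_rcons => /(_ lt_o) /eqP.
rewrite -rcons_cons nth_rcons /= lt_o => ->.
by rewrite nth_rcons !ltnS; move: lt_o; rewrite /= ltnS leq_eqVlt; case: ltngtP.
Qed.

(** Write the cycles of [s] and of [t] one after the other and match equal positions. As the shapes
    agree, the successor along a cycle has the same position on both sides. *)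
Lemma cycle_type_conj s t : s \in G -> t \in G ->
  cycle_type s = cycle_type t -> exists2 g, g \in G & t = (s ^ g)%g.
Proof.
move=> Gs Gt; rewrite /cycle_type.
have := cycles_of_cycle s; have := cycles_of_cycle t.
have := cycles_of_perm Gs; have := cycles_of_perm Gt.
move: (cycles_of s) (cycles_of t) => ss tt pt ps ct cs sh.
pose F := flatten ss; pose H := flatten tt.
have uF : uniq F by rewrite (perm_uniq ps) enum_uniq.
have uH : uniq H by rewrite (perm_uniq pt) enum_uniq.
have memF x : (x \in F) = (x \in A) by rewrite (perm_mem ps) mem_enum.
have memH x : (x \in H) = (x \in A) by rewrite (perm_mem pt) mem_enum.
have szFH : size F = size H by rewrite (perm_size ps) (perm_size pt).
(* Off [A] the index is out of range, so the default value makes [g0] the identity there. *)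
pose g0 x := nth x H (index x F).
have g0N x : x \notin A -> g0 x = x.
  by move=> nAx; rewrite /g0 nth_default // -szFH memNindex ?memF.
have ltF x : x \in A -> (index x F < size H)%N by rewrite -szFH index_mem memF.
have g0A x : x \in A -> g0 x \in A by move=> Ax; rewrite -memH mem_nth // ltF.
have g0I : injective g0.
  move=> x y; have [Ax|nAx] := boolP (x \in A); have [Ay|nAy] := boolP (y \in A).
  - rewrite /g0 (set_nth_default x y) ?ltF // => /eqP.
    rewrite nth_uniq ?ltF // => /eqP e.
    by rewrite -(nth_index x (s := F) (x := x)) ?memF // e nth_index ?memF.
  - by rewrite (g0N y) // => e; case/negP: nAy; rewrite -e g0A.
  - by rewrite (g0N x) // => e; case/negP: nAx; rewrite e g0A.
  by rewrite !g0N.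
have Gg : perm g0I \in G.
  rewrite inE; apply/subsetP => x; rewrite inE permE; apply: contraR => nAx.
  by rewrite g0N.
exists (perm g0I) => //; rewrite conjgE; apply: (canRL (mulKg _)).
apply/permP => x; rewrite !permM !permE.
have [Ax|nAx] := boolP (x \in A); last first.
  by rewrite (out_perm (S := A) (u := s)) ?g0N ?(out_perm (S := A) (u := t)) //;
     [move: Gt|move: Gs]; rewrite inE.
pose p := index x F; pose r := reshape_index (shape ss) p.
pose o := reshape_offset (shape ss) p.
have lt_p : (p < sumn (shape ss))%N by rewrite -size_flatten szFH ltF.
have lt_o : (o < nth 0%N (shape ss) r)%N by apply: reshape_offsetP.
have lt_r : (r < size ss)%N by rewrite -(size_map size); apply: reshape_indexP.
have lt_r' : (r < size tt)%N by rewrite -(size_map size) -[map _ _]sh size_map.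
have szu : size (nth [::] ss r) = nth 0%N (shape ss) r by rewrite (nth_map [::]).
have szv : size (nth [::] tt r) = nth 0%N (shape ss) r.
  by rewrite sh (nth_map [::]).
have xE : x = nth x (nth [::] ss r) o.
  by rewrite -[LHS](nth_index x (s := F)) ?memF // /F nth_flatten.
have gxE : g0 x = nth x (nth [::] tt r) o.
  by rewrite /g0 /H nth_flatten -sh.
set o' := if (o.+1 < nth 0%N (shape ss) r)%N then o.+1 else 0%N.
have lt_o' : (o' < nth 0%N (shape ss) r)%N.
  by rewrite /o'; case: ifP => // _; apply: leq_ltn_trans lt_o.
have fcu : fcycle s (nth [::] ss r) by apply: (allP cs); apply: mem_nth.
have fcv : fcycle t (nth [::] tt r) by apply: (allP ct); apply: mem_nth.
have sxE : s x = nth x F (flatten_index (shape ss) r o').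
  rewrite {1}xE fcycle_nth ?szu // -/o' /F nth_flatten.
  by rewrite flatten_indexKl // flatten_indexKr.
have lt_f : (flatten_index (shape ss) r o' < size F)%N.
  by rewrite /F size_flatten flatten_indexP.
rewrite {2}/g0 sxE index_uniq // -sxE (set_nth_default x) -?szFH //.
rewrite /H nth_flatten -sh flatten_indexKl // flatten_indexKr //.
by rewrite gxE fcycle_nth ?szv.
Qed.

End CycleType.

Section Completeness.

Variables (C : numClosedFieldType) (T : finType) (A : {set T}).
Local Notation G := (perm.Sym_group A).
Local Notation aG := (regular_repr C G).
Local Notation E la := (young_central C A la).

(* The central elements [E la] attached to the cycle types of the classes are
   linearly independent, and there are as many of them as the dimension of the
   centre. *)
Lemma young_complete : exists (I : finType) (lam : I -> seq nat) (w : I -> C),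
  (forall i, is_partition_of #|A| (lam i)) /\
  1%:M = \sum_i w i *: E (lam i) :> 'M[C]_#|G|.
Proof.
pose N := #|classes G|.
pose rp (i : 'I_N) := repr (enum_val i).
pose lam i := cycle_type A (rp i).
have rpP i : rp i \in G /\ enum_val i = (rp i ^: G)%g.
  have /imsetP[x Gx e] := enum_valP i; have := mem_repr_classes (enum_valP i).
  rewrite -/(rp i) e => /imsetP[y Gy ->]; rewrite groupJ //; split=> //.
  by rewrite classGidl.
have lamP i : is_partition_of #|A| (lam i).
  by apply: cycle_type_partition; case: (rpP i).
have lamI : injective lam.
  move=> i j e; have [[Gi ei] [Gj ej]] := (rpP i, rpP j).
  have [g Gg eg] := cycle_type_conj Gi Gj e.
  by apply: enum_val_inj; rewrite ei ej eg classGidl.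
pose M := \matrix_(i < N) mxvec (E (lam i)).
(* Multiplying a linear relation by [E (lam k)] leaves only its term [k], by orthogonality. *)
have freeM : row_free M.
  rewrite -kermx_eq0; apply/rowV0P=> v /sub_kermxP; rewrite mulmx_sum_row => v0.
  apply/rowP=> k /[1!mxE].
  have : (\sum_i v 0 i *: E (lam i)) *m E (lam k) = 0.
    suff -> : \sum_i v 0 i *: E (lam i) = 0 by rewrite mul0mx.
    apply: (can_inj mxvecK); rewrite linear0 -v0 linear_sum.
    by apply: eq_bigr => i _; rewrite rowK linearZ.
  rewrite mulmx_suml (bigD1 k) //= big1 ?addr0 => [|i nik]; last first.
    rewrite -scalemxAl young_central_orth ?scaler0 //.
    by apply: contraNneq nik => /lamI->.
  have [s s0 es] := young_central_sqr C (lamP k).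
  rewrite -scalemxAl es scalerA => /eqP; rewrite scaler_eq0.
  rewrite (negPf (young_central_neq0 C (lamP k))) orbF mulf_eq0 (negPf s0) orbF.
  by move/eqP.
have sMZ : (M <= classg_base C G)%MS.
  apply/row_subP => i; rewrite rowK classg_base_center sub_capmx.
  rewrite young_central_gring memmx_cent_envelop; apply/centgmxP => g Gg.
  by rewrite young_central_comm.
(* [M] has rank [N], the number of classes, and the class sums span at most that dimension. *)
have sZM : (classg_base C G <= M)%MS.
  rewrite -(geq_leqif (mxrank_leqif_sup sMZ)) (eqP freeM).
  exact: rank_leq_row.
have : (mxvec 1%:M <= M)%MS.
  apply: submx_trans sZM; rewrite classg_base_center sub_capmx envelop_mx1.
  by rewrite memmx_cent_envelop; apply/centgmxP => g Gg; rewrite mulmx1 mul1mx.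
case/submxP => v /(canRL mxvecK) e.
exists 'I_N, lam, (fun i => v 0 i); split=> //.
rewrite [LHS]e mulmx_sum_row linear_sum; apply: eq_bigr => i _.
by rewrite rowK linearZ /= mxvecK.
Qed.

End Completeness.

(** * Specht modules *)

Section GringOp.

Variables (F : fieldType) (gT : finGroupType) (G : {group gT}).

Lemma gring_op_sum n (rG : mx_representation F G n) z :
  gring_op rG z = \sum_i gring_row z 0 i *: rG (enum_val i).
Proof.
rewrite gring_opE /gring_mx /= mulmx_sum_row linear_sum.
by apply: eq_bigr => i _; rewrite linearZ /= rowK mxvecK.
Qed.

Lemma val_submod_gring_op n (rG : mx_representation F G n) (U : 'M_n)
    (Umod : mxmodule rG U) m (W : 'M_(m, \rank U)) z :
  val_submod (W *m gring_op (submod_repr Umod) z) = val_submod W *m gring_op rG z.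
Proof.
rewrite !gring_op_sum !mulmx_sumr linear_sum; apply: eq_bigr => i _.
by rewrite -!scalemxAr linearZ /= val_submodJ ?enum_valP.
Qed.

Lemma rsim_gring_op n1 n2 (rG1 : mx_representation F G n1)
    (rG2 : mx_representation F G n2) (B : 'M_(n1, n2)) z :
    (forall x, x \in G -> rG1 x *m B = B *m rG2 x) ->
  gring_op rG1 z *m B = B *m gring_op rG2 z.
Proof.
move=> homB; rewrite !gring_op_sum mulmx_suml mulmx_sumr; apply: eq_bigr => i _.
by rewrite -scalemxAl -scalemxAr homB ?enum_valP.
Qed.

End GringOp.

Lemma gring_op_tperm_sum (C : fieldType) (T : finType) (A B : {set T}) d
    (rG : mx_representation C (perm.Sym_group A) d) :
    B \subset A ->
  gring_op rG (tperm_sum B (regular_repr C (perm.Sym_group A))) = tperm_sum B rG.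
Proof.
move=> /subsetP sBA; rewrite /tperm_sum linear_sum; apply: eq_bigr => x Bx.
rewrite linear_sum; apply: eq_bigr => y /andP[By _].
by rewrite /= gring_opG // tperm_Sym ?sBA.
Qed.

(** * Young symmetrizers acting on arbitrary representations *)

Section SymRep.

Variables (C : numClosedFieldType) (T : finType) (A : {set T}) (d : nat).
Local Notation G := (perm.Sym_group A).
Local Notation aG := (regular_repr C G).
Variable rG : mx_representation C G d.
Local Notation Y la := (young_symmetrizer C A la).
Local Notation E la := (young_central C A la).

Lemma young_central_detect la (P : 'M_d) :
    (forall g, g \in G -> P *m rG g = rG g *m P) ->
  P *m gring_op rG (Y la) = 0 -> P *m gring_op rG (E la) = 0.
Proof.
move=> cP PY0; rewrite /young_central linear_sum mulmx_sumr big1 //= => g Gg.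
rewrite !gring_opM ?envelop_mx_id ?young_gring // !gring_opG ?groupV //.
by rewrite !mulmxA cP ?groupV // -(mulmxA _ P) PY0 mulmx0 mul0mx.
Qed.

(** Since 1 is a combination of the [E la], one of them is not killed by [P]; by
    [young_central_detect] neither is the corresponding [Y la]. *)
Lemma young_detect (P : 'M_d) :
    (forall g, g \in G -> P *m rG g = rG g *m P) -> P != 0 ->
  exists2 la, is_partition_of #|A| la & P *m gring_op rG (Y la) != 0.
Proof.
move=> cP nzP; have [I [lam [w [lamP e1]]]] := young_complete C A.
have [i nz] : exists i, P *m gring_op rG (Y (lam i)) != 0.
  apply/existsP; apply: contraNT nzP => /existsPn P0.
  rewrite -[P]mulmx1 -(gring_op1 rG) [1%:M]e1 linear_sum mulmx_sumr big1 //.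
  move=> i _; rewrite linearZ -scalemxAr young_central_detect ?scaler0 //.
  by apply/eqP; rewrite -[_ == _]negbK P0.
by exists (lam i).
Qed.

(** The scalar is chosen before the representation, so that two representations can later be
    compared through it. *)
Lemma young_op_sandwich la g : is_partition_of #|A| la -> g \in G ->
  exists s, forall d' (rH : mx_representation C G d'),
    gring_op rH (Y la) *m rH g *m gring_op rH (Y la) = s *: gring_op rH (Y la).
Proof.
move=> laP Gg; have [s es] := young_sandwich C laP Gg; exists s => d' rH.
by rewrite -linearZ -es /= !gring_opM ?envelop_mx_id ?young_gring // gring_opG.
Qed.

Lemma young_op_sqr la : is_partition_of #|A| la ->
  exists2 s, s != 0 & forall d' (rH : mx_representation C G d'),
    gring_op rH (Y la) *m gring_op rH (Y la) = s *: gring_op rH (Y la).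
Proof.
move=> laP; have [s s0 es] := young_sqr C laP; exists s => // d' rH.
by rewrite -linearZ -es /= !gring_opM ?young_gring.
Qed.

End SymRep.

Section Specht.

Variables (C : numClosedFieldType) (T : finType) (A : {set T}) (la : seq nat).
Local Notation G := (perm.Sym_group A).
Local Notation aG := (regular_repr C G).
Local Notation Y := (young_symmetrizer C A la).
Local Notation rS := (specht_repr C A la).

Lemma specht_rank_gt0 : (0 < \rank (specht_mx C A la))%N.
Proof.
rewrite lt0n mxrank_eq0 /specht_mx cyclic_mx_eq0.
apply: contraNneq (young_neq0 C A la) => Y0.
by rewrite -(gring_rowK (young_gring C A la)) Y0 linear0.
Qed.

(** Every vector of the Specht module is [Y] times some [B] of the group algebra, and [z] commutes
    with [B], so its action is decided on [Y]. *)
Lemma specht_central_scalar z s : (z \in group_ring C G)%MS ->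
    (forall g, g \in G -> aG g *m z = z *m aG g) ->
  Y *m z = s *: Y -> gring_op rS z = s%:M.
Proof.
move=> Rz cz Yz; apply: (@val_submod_inj _ _ (specht_mx C A la)).
rewrite -[gring_op rS z]mul1mx val_submod_gring_op gring_op_id //.
rewrite -[s%:M]mulmx1 mul_scalar_mx linearZ /=.
set V := val_submod 1%:M; have : (V <= specht_mx C A la)%MS by apply: val_submodP.
move: V => V sV; apply/row_matrixP => i; rewrite row_mul linearZ /=.
have /cyclic_mxP[B RB ->] := submx_trans (row_sub i V) sV.
have cB : B *m z = z *m B.
  case/envelop_mxP: RB => w ->; rewrite mulmx_suml mulmx_sumr.
  by apply: eq_bigr => x Gx; rewrite -scalemxAl -scalemxAr cz.
rewrite -mulmxA cB mulmxA -gring_row_mul Yz linearZ /=.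
by rewrite -scalemxAl.
Qed.

Hypothesis laP : is_partition_of #|A| la.

Lemma specht_young_central :
  exists2 s, s != 0 & gring_op rS (young_central C A la) = s%:M.
Proof.
have [s s0 es] := young_mul_central C laP; exists s => //.
apply: specht_central_scalar => //; first exact: young_central_gring.
by move=> g Gg; apply: young_central_comm.
Qed.

Lemma specht_tperm_sum : tperm_sum A rS = (content_q C la *+ 2)%:M.
Proof.
rewrite -gring_op_tperm_sum //; apply: specht_central_scalar.
- rewrite linear_sum summx_sub //= => x Ax; rewrite linear_sum summx_sub //=.
  by move=> y /andP[Ay _]; rewrite envelop_mx_id // tperm_Sym.
- by move=> g Gg; apply: tperm_sum_comm => // x; rewrite Sym_closed.
exact: young_tperm_sum.
Qed.

End Specht.

(** * Young subgroups and outer tensor products *)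

Section TensorLinear.

Variables (F : fieldType) (m1 n1 m2 n2 : nat).

Lemma tprod_linearl (B : 'M[F]_(m2, n2)) a (A A' : 'M[F]_(m1, n1)) :
  tprod (a *: A + A') B = a *: tprod A B + tprod A' B.
Proof.
elim: m1 A A' => [|m IHm] A A' /=; first by rewrite scaler0 addr0.
by rewrite !linearP /= IHm -!trowbE linearP /= scale_col_mx add_col_mx.
Qed.

Lemma tprod_linearr (A : 'M[F]_(m1, n1)) a (B B' : 'M[F]_(m2, n2)) :
  tprod A (a *: B + B') = a *: tprod A B + tprod A B'.
Proof.
elim: m1 A => [|m IHm] A /=; first by rewrite scaler0 addr0.
by rewrite IHm linearP /= scale_col_mx add_col_mx.
Qed.

Lemma tprod0l (B : 'M[F]_(m2, n2)) : tprod (0 : 'M[F]_(m1, n1)) B = 0.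
Proof.
have := tprod_linearl B (-1) 0 (0 : 'M[F]_(m1, n1)).
by rewrite scaler0 addr0 scaleN1r addNr.
Qed.

Lemma tprod0r (A : 'M[F]_(m1, n1)) : tprod A (0 : 'M[F]_(m2, n2)) = 0.
Proof.
have := tprod_linearr A (-1) 0 (0 : 'M[F]_(m2, n2)).
by rewrite scaler0 addr0 scaleN1r addNr.
Qed.

Lemma tprod_suml (I : finType) (c : I -> F) (A : I -> 'M[F]_(m1, n1))
    (B : 'M[F]_(m2, n2)) :
  \sum_i c i *: tprod (A i) B = tprod (\sum_i c i *: A i) B.
Proof.
elim/big_rec2: _ => [|i u v _ ->]; first by rewrite tprod0l.
by rewrite tprod_linearl.
Qed.

Lemma tprod_sumr (I : finType) (c : I -> F) (A : 'M[F]_(m1, n1))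
    (B : I -> 'M[F]_(m2, n2)) :
  \sum_i c i *: tprod A (B i) = tprod A (\sum_i c i *: B i).
Proof.
elim/big_rec2: _ => [|i u v _ ->]; first by rewrite tprod0r.
by rewrite tprod_linearr.
Qed.

End TensorLinear.

(** * The blocks and their symmetric groups inside the Young subgroup *)

Section Blocks.

Variables (n : nat) (eta : seq nat).
Local Notation B k := (@block n eta k).
Local Notation I := 'I_(size eta).
Local Notation Geta := (young_subgroup n eta).

Lemma leq_sumn_take i j : (i <= j)%N -> (sumn (take i eta) <= sumn (take j eta))%N.
Proof.
move=> le_ij; rewrite -(take_takel _ le_ij) -[X in (_ <= sumn X)%N](cat_take_drop i).
by rewrite sumn_cat leq_addr.
Qed.

Lemma block_inj (k l : I) x : x \in B k -> x \in B l -> k = l.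
Proof.
rewrite !inE => /andP[kx xk] /andP[lx xl]; apply: ord_inj.
case: (ltngtP k l) => // lt.
  by have := leq_sumn_take lt; rewrite leqNgt (leq_ltn_trans lx xk).
by have := leq_sumn_take lt; rewrite leqNgt (leq_ltn_trans kx xl).
Qed.

Lemma young_subgroupP (g : 'S_n) :
  reflect (forall (k : I) x, (g x \in B k) = (x \in B k)) (g \in Geta).
Proof.
apply: (iffP bigcapP) => [h k x|h k _]; first exact: (astabsP (h k isT) x).
by apply/astabsP => x; apply: h.
Qed.

Lemma Sym_block_sub (k : I) : perm.Sym (B k) \subset Geta.
Proof.
apply/subsetP => s Bs; apply/young_subgroupP => l x.
have [Bx|nBx] := boolP (x \in B k); last by move: Bs; rewrite inE => /out_perm->.
have Bsx : s x \in B k by rewrite Sym_closed.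
apply/idP/idP => Bl; first by rewrite -(block_inj Bsx Bl).
by rewrite -(block_inj Bx Bl).
Qed.

Lemma restr_perm_block_id (k : I) g :
  g \in perm.Sym (B k) -> restr_perm (B k) g = g.
Proof.
move=> Bg; have /young_subgroupP gB := subsetP (Sym_block_sub k) _ Bg.
apply/permP => x; have [Bx|nBx] := boolP (x \in B k).
  by apply: restr_permE => //; apply/astabsP => y; apply: gB.
rewrite (out_perm (restr_perm_on _ _)) //.
by move: Bg; rewrite inE => /out_perm->.
Qed.

Lemma restr_perm_block_triv (k l : I) g :
  l != k -> g \in perm.Sym (B k) -> restr_perm (B l) g = 1%g.
Proof.
move=> nlk Bg; have /young_subgroupP gB := subsetP (Sym_block_sub k) _ Bg.
apply/permP => x; rewrite perm1; have [Bx|nBx] := boolP (x \in B l); last first.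
  by rewrite (out_perm (restr_perm_on _ _)).
rewrite restr_permE //.
  move: Bg; rewrite inE => /out_perm-> //.
  by apply: contra nlk => Bkx; rewrite (block_inj Bx Bkx).
by apply/astabsP => y; apply: gB.
Qed.

Lemma Sym_block_commute (k : I) g h : g \in Geta ->
    {in B k, forall x, g x = x} -> h \in perm.Sym (B k) ->
  (g * h = h * g)%g.
Proof.
move=> Gg gB; rewrite inE => hB; have gC : perm_on (~: B k) g.
  by apply/subsetP => x; rewrite !inE; apply: contra => Bx; rewrite gB // inE.
apply: perm_onC gC hB _; rewrite -setI_eq0; apply/eqP/setP => x.
by rewrite !inE andNb.
Qed.

Hypothesis etaS : sumn eta = n.

Lemma sumn_take_leq k : (sumn (take k eta) <= n)%N.
Proof.
rewrite -etaS -[X in (_ <= sumn X)%N](cat_take_drop k) sumn_cat.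
exact: leq_addr.
Qed.

Lemma sumn_takeS (k : I) :
  sumn (take k.+1 eta) = (sumn (take k eta) + nth 0%N eta k)%N.
Proof. by rewrite (take_nth 0%N) // sumn_rcons. Qed.

Lemma block_cover (x : 'I_n) : exists k : I, x \in B k.
Proof.
have lt : (x < sumn eta)%N by rewrite etaS.
exists (Ordinal (reshape_indexP lt)); rewrite inE sumn_takeS /=.
have := reshape_offsetP lt; have := reshape_indexK eta x.
rewrite /flatten_index; move: (reshape_index _ _) (reshape_offset _ _) => r o <-.
by rewrite leq_addr ltn_add2l.
Qed.

Lemma card_block (k : I) : #|B k| = nth 0%N eta k.
Proof.
rewrite cardsE -sum1_card.
rewrite -(big_mkord (fun i => sumn (take k eta) <= i < sumn (take k.+1 eta))%N
  (fun=> 1%N)) /=.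
rewrite -(@big_nat_widen _ _ _ 0%N (sumn (take k.+1 eta)) n
  (fun i => sumn (take k eta) <= i)%N (fun=> 1%N)) ?sumn_take_leq //.
rewrite -(@big_nat_widenl _ _ _ (sumn (take k eta)) 0%N _ xpredT (fun=> 1%N)) //.
by rewrite sum_nat_const_nat muln1 sumn_takeS addKn.
Qed.

End Blocks.

(** * Outer tensor products of Specht modules *)

Section OuterTensor.

Variables (C : fieldType) (n : nat) (eta : seq nat).
Local Notation B k := (@block n eta k).
Local Notation I := 'I_(size eta).
Local Notation Geta := (young_subgroup n eta).
Variable beta : I -> seq nat.

Local Notation tens s := (\big[@prod_grepr C _ Geta/triv_grepr C Geta]_(k <- s)
  factor_repr n C k (beta k)).

Lemma factor_repr_id (k : I) g : g \in perm.Sym (B k) ->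
  factor_repr n C k (beta k) g = specht_repr C (B k) (beta k) g.
Proof. by move=> Bg /=; rewrite /morphpre_mx_repr /= restr_perm_block_id. Qed.

Lemma factor_repr_triv (k l : I) g : l != k -> g \in perm.Sym (B k) ->
  factor_repr n C l (beta l) g = 1%:M.
Proof.
move=> nlk Bg; transitivity (specht_repr C (B l) (beta l) 1%g).
  by rewrite /= (restr_perm_block_triv nlk Bg).
exact: repr_mx1.
Qed.

Lemma tens_triv (k : I) s g : k \notin s -> g \in perm.Sym (B k) -> tens s g = 1%:M.
Proof.
move=> ks Bg; elim: s ks => [|l s IHs]; first by rewrite big_nil.
rewrite inE negb_or => /andP[kl ks]; rewrite big_cons.
transitivity (tprod (factor_repr n C l (beta l) g) (tens s g)); first by [].
by rewrite IHs // (factor_repr_triv _ Bg) 1?eq_sym // tprod1.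
Qed.

(** Permutations of block [k] act as the identity on all other factors, so the relation involves a
    single tensor factor, in which [tprod] is linear. *)
Lemma tens_factor (k : I) s (J : finType) (c : J -> C) (h : J -> 'S_n) :
    uniq s -> k \in s -> (forall i, h i \in perm.Sym (B k)) ->
    \sum_i c i *: specht_repr C (B k) (beta k) (h i) = 0 ->
  \sum_i c i *: tens s (h i) = 0.
Proof.
move=> us ks hB h0; elim: s us ks => // l s IHs /= /andP[ls us].
rewrite inE big_cons => ks.
transitivity
    (\sum_i c i *: tprod (factor_repr n C l (beta l) (h i)) (tens s (h i))).
  by [].
have [elk|nlk] := eqVneq l k.
  rewrite {}elk in ls *.
  rewrite (eq_bigr (fun i => c i *: tprod (specht_repr C (B k) (beta k) (h i)) 1%:M)).
    by rewrite tprod_suml h0 tprod0l.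
  by move=> i _; rewrite (tens_triv ls (hB i)) factor_repr_id.
rewrite (eq_bigr (fun i => c i *: tprod 1%:M (tens s (h i)))) => [|i _].
  by rewrite tprod_sumr IHs ?tprod0r //; move: ks; rewrite eq_sym (negPf nlk).
by rewrite (factor_repr_triv nlk (hB i)).
Qed.

Local Notation R := (outer_tensor n C beta).

Lemma outer_tensor_factor (k : I) z :
    gring_op (specht_repr C (B k) (beta k)) z = 0 ->
  gring_op (subg_repr R (Sym_block_sub n k)) z = 0.
Proof.
rewrite !gring_op_sum => z0.
apply: (tens_factor (s := index_enum I) _ _ _ z0) => [||i].
- exact: index_enum_uniq.
- exact: mem_index_enum.
exact: (enum_valP i).
Qed.

Lemma outer_tensor_scalar (k : I) z c :
    gring_op (specht_repr C (B k) (beta k)) z = c%:M ->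
  gring_op (subg_repr R (Sym_block_sub n k)) z = c%:M.
Proof.
move=> ez; have : gring_op (specht_repr C (B k) (beta k)) (z - c *: 1%:M) = 0.
  by rewrite linearB linearZ /= gring_op1 ez scalemx1 subrr.
move/outer_tensor_factor/eqP.
by rewrite linearB linearZ /= gring_op1 scalemx1 subr_eq0 => /eqP.
Qed.

Lemma outer_tensor_degree :
  (forall k, 0 < \rank (specht_mx C (B k) (beta k)))%N -> (0 < rdegree R)%N.
Proof.
move=> dk; rewrite /outer_tensor; elim: (index_enum _) => [|k s IHs].
  by rewrite big_nil.
by rewrite big_cons /= muln_gt0 dk IHs.
Qed.

End OuterTensor.

(** * Products of Young symmetrizers *)

Section YoungProduct.

Variables (C : numClosedFieldType) (n : nat) (eta : seq nat).
Local Notation B k := (@block n eta k).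
Local Notation I := 'I_(size eta).
Local Notation Geta := (young_subgroup n eta).
Local Notation block_repr rG k := (subg_repr rG (Sym_block_sub n k)).

(** The symmetrizer lives in the group algebra of the symmetric group of one block, so it acts
    through the restriction of [rG], and products over blocks are taken among operators. *)
Definition block_young (beta : I -> seq nat) d (rG : mx_representation C Geta d)
    (k : I) : 'M[C]_d :=
  gring_op (block_repr rG k) (young_symmetrizer C (B k) (beta k)).

Definition young_prod beta d (rG : mx_representation C Geta d) (s : seq I) :=
  foldr (fun k M => block_young beta rG k *m M) 1%:M s.

Section OneRep.

Variables (d : nat) (rG : mx_representation C Geta d) (beta : I -> seq nat).
Local Notation Y k := (block_young beta rG k).
Local Notation YP s := (young_prod beta rG s).

Lemma comm_gring_block (k : I) (M : 'M_d) z :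
    (forall h, h \in perm.Sym (B k) -> M *m rG h = rG h *m M) ->
  M *m gring_op (block_repr rG k) z = gring_op (block_repr rG k) z *m M.
Proof.
move=> cM; rewrite gring_op_sum mulmx_suml mulmx_sumr; apply: eq_bigr => i _.
by rewrite -scalemxAl -scalemxAr /= cM //; apply: (enum_valP i).
Qed.

Lemma fix_block_young_comm (k : I) g : g \in Geta -> {in B k, forall x, g x = x} ->
  rG g *m Y k = Y k *m rG g.
Proof.
move=> Gg gB; apply: comm_gring_block => h Bh.
have Gh := subsetP (Sym_block_sub n k) h Bh.
by rewrite -!repr_mxM // (Sym_block_commute Gg gB Bh).
Qed.

Lemma Sym_block_fix (k l : I) h x : k != l -> h \in perm.Sym (B l) -> x \in B k ->
  h x = x.
Proof.
move=> nkl; rewrite inE => /out_perm hB Bx; apply: hB.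
by apply: contra nkl => Blx; rewrite (block_inj Bx Blx).
Qed.

Lemma block_young_commSym (k l : I) h : k != l -> h \in perm.Sym (B l) ->
  Y k *m rG h = rG h *m Y k.
Proof.
move=> nkl Bh; rewrite fix_block_young_comm ?(subsetP (Sym_block_sub n l)) //.
by move=> x; apply: Sym_block_fix Bh.
Qed.

Lemma block_young_comm (k l : I) : Y k *m Y l = Y l *m Y k.
Proof.
have [->//|nkl] := eqVneq k l.
by apply: comm_gring_block => h Bh; apply: block_young_commSym Bh.
Qed.

Lemma young_prod_comm (M : 'M_d) s :
  (forall k, k \in s -> M *m Y k = Y k *m M) -> M *m YP s = YP s *m M.
Proof.
elim: s => [|k s IHs] cM /=; first by rewrite mulmx1 mul1mx.
rewrite mulmxA cM ?mem_head // -!mulmxA IHs // => l ls.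
by apply: cM; rewrite inE ls orbT.
Qed.

Lemma central_young_prod (M : 'M_d) s :
  (forall g, g \in Geta -> M *m rG g = rG g *m M) -> M *m YP s = YP s *m M.
Proof.
move=> cM; apply: young_prod_comm => k _; apply: comm_gring_block => h Bh.
by apply: cM; apply: (subsetP (Sym_block_sub n k)).
Qed.

End OneRep.

(** Factors of distinct blocks commute, so their scalars multiply; again the scalar is independent
    of the representation. *)
Lemma young_prod_sqr beta s :
    (forall k, is_partition_of #|B k| (beta k)) ->
  exists2 c, c != 0 & forall d (rG : mx_representation C Geta d),
    young_prod beta rG s *m young_prod beta rG s = c *: young_prod beta rG s.
Proof.
move=> bP; elim: s => [|k s [c c0 IHs]].
  by exists 1; rewrite ?oner_eq0 // => d rG; rewrite mulmx1 scale1r.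
have [c' c'0 ec'] := young_op_sqr C (bP k).
exists (c' * c) => [|d rG]; first by rewrite mulf_neq0.
rewrite /= -mulmxA (mulmxA (young_prod _ _ _)) -young_prod_comm; last first.
  by move=> l _; apply: block_young_comm.
rewrite -!mulmxA IHs mulmxA /block_young ec' -scalemxAl -scalemxAr scalerA.
by [].
Qed.

(* Splitting [g] into its component on the block [k] and the rest, which
   commutes with [Sym (B k)], reduces the claim to a single factor. *)
Lemma young_prod_sandwich beta s g :
    (forall k, is_partition_of #|B k| (beta k)) ->
    uniq s -> g \in Geta ->
    (forall x, (forall k, k \in s -> x \notin B k) -> g x = x) ->
  exists c, forall d (rG : mx_representation C Geta d),
    young_prod beta rG s *m rG g *m young_prod beta rG s
      = c *: young_prod beta rG s.
Proof.
move=> bP; elim: s g => [|k s IHs] g us Gg gfix.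
  exists 1 => d rG; suff -> : g = 1%g by rewrite /= repr_mx1 !mulmx1 scale1r.
  by apply/permP => x; rewrite perm1 gfix.
case/andP: us => ks us; pose h := restr_perm (B k) g.
have Bh : h \in perm.Sym (B k) by rewrite inE restr_perm_on.
have Gh := subsetP (Sym_block_sub n k) h Bh.
have /young_subgroupP gB := Gg.
have hE x : x \in B k -> h x = g x.
  by move=> Bx; apply: restr_permE => //; apply/astabsP => y; apply: gB.
have hV x : x \in B k -> (h^-1)%g x \in B k.
  by move=> Bx; rewrite (@Sym_closed _ (B k)) ?groupV.
pose g' := (h^-1 * g)%g.
have Gg' : g' \in Geta by rewrite groupM ?groupV.
have g'k : {in B k, forall x, g' x = x}.
  by move=> x Bx; rewrite permM -hE ?hV // permKV.
have [|c ec] := IHs g' us Gg' _.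
  move=> x xs; have [Bx|nBx] := boolP (x \in B k); first exact: g'k.
  rewrite permM (_ : (h^-1)%g x = x).
    by apply: gfix => l; rewrite inE => /predU1P[->//|/xs].
  by rewrite (out_perm (perm_onV (restr_perm_on _ _))).
have [c' ec'] := young_op_sandwich C (bP k) Bh.
exists (c' * c) => d rG; have := ec' d (block_repr rG k).
rewrite -[gring_op _ _]/(block_young beta rG k) -[block_repr rG k h]/(rG h) => {}ec'.
rewrite [young_prod _ _ (k :: s)]/=.
set P := young_prod beta rG s; set Yk := block_young beta rG k in ec' *.
have cP : Yk *m P = P *m Yk.
  by apply: young_prod_comm => l _; apply: block_young_comm.
have -> : rG g = rG h *m rG g' by rewrite -repr_mxM // mulKVg.
have cg : rG g' *m Yk = Yk *m rG g' by apply: fix_block_young_comm.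
(* The product is rearranged as [P (Yk h Yk) g' P]; once the inner scalar is extracted, [Yk] moves
   out and [P g' P] remains. *)
rewrite {1}cP -!mulmxA (mulmxA (rG g')) cg -!mulmxA (mulmxA Yk (rG h)).
rewrite (mulmxA (Yk *m rG h)) ec' -scalemxAl -scalemxAr -scalerA; congr (_ *: _).
by rewrite mulmxA -cP -!mulmxA (mulmxA P) ec -scalemxAr.
Qed.

(** One block at a time: after [young_detect] for block [k], [P *m Yk] is nonzero and still commutes
    with the groups of the other blocks. *)
Lemma young_prod_detect d (rG : mx_representation C Geta d) s (P : 'M_d) :
    uniq s -> P != 0 ->
    (forall k h, k \in s -> h \in perm.Sym (B k) -> P *m rG h = rG h *m P) ->
  exists2 beta, forall k, k \in s -> is_partition_of #|B k| (beta k)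
    & P *m young_prod beta rG s != 0.
Proof.
elim: s P => [|k s IHs] P /=; first by exists (fun=> [::]); rewrite ?mulmx1.
case/andP=> ks us nzP cP.
have [|la laP nzPY] := @young_detect C _ (B k) d (block_repr rG k) P _ nzP.
  by move=> g; apply: cP; rewrite mem_head.
set Yk := gring_op _ _ in nzPY.
have [|beta bP nz] := IHs (P *m Yk) us nzPY.
  move=> l h ls Bh; rewrite -mulmxA (_ : Yk *m rG h = rG h *m Yk).
    by rewrite !mulmxA (cP l) // inE ls orbT.
  apply: (@block_young_commSym d rG (fun=> la) k l) => //.
  by apply: contraNneq ks => ->.
exists (fun l => if l == k then la else beta l) => [l|].
  by rewrite inE; case: eqP => [->//|_ /= /bP].
rewrite /= mulmxA {1}/block_young eqxx -/Yk.
suff -> : young_prod (fun l => if l == k then la else beta l) rG s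
    = young_prod beta rG s by [].
elim: (s) ks => //= l r IHr; rewrite inE negb_or => /andP[kl kr].
by rewrite IHr // /block_young [l == k]eq_sym (negPf kl).
Qed.

(** On the outer tensor product the central element of [beta k] acts by a nonzero scalar, so it
    kills no nonzero [P]; hence neither does the symmetrizer. *)
Lemma outer_young_prod_detect (beta : I -> seq nat) s
    (R := outer_tensor n C beta) (P : 'M_(rdegree R)) :
    (forall k, is_partition_of #|B k| (beta k)) -> uniq s -> P != 0 ->
    (forall k h, k \in s -> h \in perm.Sym (B k) -> P *m R h = R h *m P) ->
  P *m young_prod beta R s != 0.
Proof.
move=> bP; elim: s P => [|k s IHs] P /=; first by rewrite mulmx1.
case/andP=> ks us nzP cP; rewrite mulmxA; apply: IHs => // [|l h ls Bh].
  have [c c0 ec] := specht_young_central C (bP k).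
  apply: contraNneq nzP => PY0.
  have PE0 := @young_central_detect C _ (B k) _ (block_repr R k) (beta k) P
    (fun g => cP k g (mem_head _ _)) PY0.
  move: PE0; rewrite (outer_tensor_scalar ec) mul_mx_scalar => /eqP.
  by rewrite scaler_eq0 (negPf c0).
rewrite -mulmxA (block_young_commSym _ _ _ Bh); last by apply: contraNneq ks => ->.
by rewrite !mulmxA (cP l) // inE ls orbT.
Qed.

End YoungProduct.

(** * Irreducible representations of the Young subgroup *)

Section IrrComp.

Variables (C : numClosedFieldType) (gT : finGroupType) (G : {group gT}).
Local Notation aG := (regular_repr C G).
Variable sG : irrType C G.
Local Notation e i := (Wedderburn_id i).

Lemma num_pchar'_group : [pchar C]^'.-group G.
Proof. by apply/pgroupP=> p _; rewrite inE /= pchar_num. Qed.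
Local Notation C'G := num_pchar'_group.

Lemma Wedderburn_id_gring (i : sG) : (e i \in group_ring C G)%MS.
Proof. by rewrite -(Wedderburn_sum_pchar sG C'G) (sumsmx_sup i) ?Wedderburn_id_mem. Qed.

Lemma Wedderburn_id_comm (i : sG) x : x \in G -> e i *m aG x = aG x *m e i.
Proof.
move=> Gx; have [_ Re eA Ae] := Wedderburn_is_id_pchar C'G i.
have /andP[/mulsmx_subP idl /mulsmx_subP idr] := Wedderburn_ideal i.
have Rx : (aG x \in group_ring C G)%MS by apply: envelop_mx_id.
by rewrite -[LHS]Ae ?idr // -mulmxA eA // idl.
Qed.

Lemma op_Wedderburn_id_comm d (rG : mx_representation C G d) (i : sG) x :
  x \in G -> gring_op rG (e i) *m rG x = rG x *m gring_op rG (e i).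
Proof.
move=> Gx; rewrite -(gring_opG rG Gx) -!gring_opM ?envelop_mx_id //.
  by rewrite Wedderburn_id_comm.
exact: Wedderburn_id_gring.
Qed.

Lemma op_Wedderburn_id_orth d (rG : mx_representation C G d) (i j : sG) :
  i != j -> gring_op rG (e i) *m gring_op rG (e j) = 0.
Proof.
move=> nij; rewrite -gring_opM ?Wedderburn_id_gring //.
by rewrite (Wedderburn_mulmx0 nij) ?Wedderburn_id_mem ?linear0.
Qed.

Lemma op_Wedderburn_id_idem d (rG : mx_representation C G d) (i : sG) :
  gring_op rG (e i) *m gring_op rG (e i) = gring_op rG (e i).
Proof.
rewrite -gring_opM ?Wedderburn_id_gring //.
by have [_ Re eA _] := Wedderburn_is_id_pchar C'G i; rewrite eA.
Qed.

(** The default value of [irr_comp] is reached only if every Wedderburn idempotent acts as 0, which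
    is impossible in positive degree since they sum to 1. For a reducible representation, [irr_comp]
    selects the type of one constituent. *)
Lemma op_irr_comp_neq0 d (rG : mx_representation C G d) :
  (0 < d)%N -> gring_op rG (e (irr_comp sG rG)) != 0.
Proof.
move=> d_gt0; rewrite /irr_comp; case: pickP => [i //|op0].
have : (1%:M : 'M[C]_d) != 0 by rewrite -mxrank_eq0 mxrank1 -lt0n.
rewrite -(gring_op1 rG) -(Wedderburn_sum_id_pchar sG C'G) linear_sum big1 ?eqxx //.
by move=> i _; apply/eqP; rewrite -[_ == _]negbK op0.
Qed.

Lemma op_irr_comp_id d (rG : mx_representation C G d) :
  mx_irreducible rG -> gring_op rG (e (irr_comp sG rG)) = 1%:M.
Proof.
move=> irrG; rewrite -(gring_op1 rG) -(Wedderburn_sum_id_pchar sG C'G) linear_sum.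
rewrite (bigD1 (irr_comp sG rG)) //= big1 ?addr0 // => i ni.
by apply: (irr_comp'_op0_pchar C'G irrG ni); apply: Wedderburn_id_mem.
Qed.

(** A simple submodule [U] of the image of the idempotent [e j] in [rR] has type [j], so it is
    isomorphic to [rM]; the scalar restricts to [U] and is transported. *)
Lemma irr_comp_scalar d (rM : mx_representation C G d) d'
    (rR : mx_representation C G d') z c :
    mx_irreducible rM -> (0 < d')%N -> irr_comp sG rM = irr_comp sG rR ->
  gring_op rR z = c%:M -> gring_op rM z = c%:M.
Proof.
move=> irrM d'_gt0 eqc rz; set j := irr_comp sG rR in eqc.
have nzj : gring_op rR (e j) != 0 by apply: op_irr_comp_neq0.
have modj : mxmodule rR (gring_op rR (e j)).
  by apply/mxmoduleP => x Gx; rewrite op_Wedderburn_id_comm // submxMl.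
have [U simU sUj] := dec_mxsimple_exists modj nzj.
have [modU nzU _] := simU; pose rU := submod_repr modU.
have irrU : mx_irreducible rU by apply/submod_mx_irr.
have rUj : gring_op rU (e j) = 1%:M.
  apply: (@val_submod_inj _ _ U); rewrite -[gring_op _ _]mul1mx val_submod_gring_op.
  have /submxP[D ->] := submx_trans (val_submodP (1%:M : 'M_(\rank U))) sUj.
  by rewrite -mulmxA op_Wedderburn_id_idem.
have rkU : (0 < \rank U)%N by rewrite lt0n mxrank_eq0.
have cU : irr_comp sG rU = j.
  apply/eqP; apply: contraT => ncU; have /eqP := oner_neq0 C; case.
  have r0 : gring_op rU (e j) = 0.
    by apply: (irr_comp'_op0_pchar C'G irrU) (Wedderburn_id_mem j); rewrite eq_sym.
  move: rUj; rewrite r0 => /matrixP/(_ (Ordinal rkU) (Ordinal rkU)).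
  by rewrite !mxE eqxx.
have rUz : gring_op rU z = c%:M.
  apply: (@val_submod_inj _ _ U); rewrite -[gring_op _ _]mul1mx val_submod_gring_op.
  by rewrite rz mul_mx_scalar -[c%:M]mulmx1 mul_scalar_mx linearZ.
have : mx_rsim rM rU.
  apply: mx_rsim_trans (rsim_irr_comp_pchar sG C'G irrM) _.
  by rewrite eqc -cU; apply: mx_rsim_sym; apply: (rsim_irr_comp_pchar sG C'G irrU).
case=> B _ freeB homB; apply: (row_free_inj freeB).
by rewrite (rsim_gring_op _ homB) rUz mul_mx_scalar mul_scalar_mx.
Qed.

End IrrComp.

(** * Types of the irreducible representations of the Young subgroup *)

Section YoungIrr.

Variables (C : numClosedFieldType) (n : nat) (eta : seq nat).
Hypothesis etaS : sumn eta = n.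
Local Notation B k := (@block n eta k).
Local Notation I := 'I_(size eta).
Local Notation Geta := (young_subgroup n eta).
Variable sG : irrType C Geta.
Local Notation e i := (Wedderburn_id i).

Lemma outer_tensor_degree_gt0 (beta : I -> seq nat) :
  (0 < rdegree (outer_tensor n C beta))%N.
Proof. by apply: outer_tensor_degree => k; apply: specht_rank_gt0. Qed.

(* If the product of Young symmetrizers acts nontrivially both on [rM] and on
   the component of [outer_tensor n C beta] of another type, then sandwiching
   the central idempotent of [rM] gives contradictory scalars. *)
Lemma irr_comp_outer_exists d (rM : mx_representation C Geta d) :
    mx_irreducible rM ->
  exists2 beta : I -> seq nat, forall k, is_partition_of #|B k| (beta k)
    & irr_comp sG rM = irr_comp sG (outer_tensor n C beta).
Proof.
move=> irrM; pose s := index_enum I.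
have us : uniq s by apply: index_enum_uniq.
have memS k : k \in s by apply: mem_index_enum.
have d_gt0 : (0 < d)%N by case/mx_irrP: irrM.
have nz1 : (1%:M : 'M[C]_d) != 0 by rewrite -mxrank_eq0 mxrank1 -lt0n.
have [|beta bP0] := young_prod_detect us nz1 (rG := rM).
  by move=> k h _ _; rewrite mulmx1 mul1mx.
have bP k : is_partition_of #|B k| (beta k) by apply: bP0.
rewrite mul1mx => nzYM; exists beta => //; pose R := outer_tensor n C beta.
set i0 := irr_comp sG rM; set j := irr_comp sG _; apply/eqP/negPn/negP => nij.
have nzj : gring_op R (e j) != 0 := op_irr_comp_neq0 _ _ (outer_tensor_degree_gt0 _).
have cj g : g \in Geta -> gring_op R (e j) *m R g = R g *m gring_op R (e j).
  exact: op_Wedderburn_id_comm.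
have nzYR : gring_op R (e j) *m young_prod beta R s != 0.
  apply: outer_young_prod_detect => // k h _ Bh.
  by apply: cj; apply: (subsetP (Sym_block_sub n k)).
(* Sandwiching is linear in the middle factor, so the idempotent also gives one scalar valid in all
   representations. *)
have [c ec] : exists c, forall d' (rG : mx_representation C Geta d'),
    young_prod beta rG s *m gring_op rG (e i0) *m young_prod beta rG s
      = c *: young_prod beta rG s.
  have /fin_all_exists[f fP] : forall i : 'I_#|Geta|, exists c,
      forall d' (rG : mx_representation C Geta d'),
      young_prod beta rG s *m rG (enum_val i) *m young_prod beta rG s
        = c *: young_prod beta rG s.
    move=> i; apply: young_prod_sandwich => //; first exact: enum_valP.
    by move=> x xB; have [k Bx] := block_cover etaS x; case/negP: (xB k (memS k)).
  exists (\sum_i gring_row (e i0) 0 i * f i) => d' rG.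
  rewrite gring_op_sum mulmx_sumr mulmx_suml scaler_suml; apply: eq_bigr => i _.
  by rewrite -scalemxAr -scalemxAl fP scalerA.
have [c' c'0 ec'] := young_prod_sqr C s bP.
(* On [rM] the idempotent of its own type is the identity, so the sandwich is the square. *)
have cc' : c = c'.
  have := ec _ rM; rewrite op_irr_comp_id // mulmx1 ec' => /eqP.
  by rewrite -subr_eq0 -scalerBl scaler_eq0 (negPf nzYM) orbF subr_eq0 => /eqP.
have nji : j != i0 by rewrite eq_sym.
have cY := central_young_prod beta s cj; have orth := op_Wedderburn_id_orth R nji.
have := ec _ R; move: nzYR cY orth.
move: (young_prod beta R s) (gring_op R (e j)) (gring_op R (e i0)).
(* In [R], the operator [P *m YR *m Q *m YR] vanishes because [P] commutes with [YR] and
   [P *m Q = 0]. *)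
move=> YR P Q nzP cY orth eQ; have /eqP : c *: (P *m YR) = 0.
  by rewrite scalemxAr -eQ !mulmxA cY -(mulmxA YR P) orth mulmx0 mul0mx.
by rewrite scaler_eq0 (negPf nzP) cc' (negPf c'0).
Qed.

(** The scalar on the Specht module of block [k] passes to the outer tensor product, then to [rM] by
    [irr_comp_scalar]. *)
Lemma irr_comp_outer_tperm_sum d (rM : mx_representation C Geta d) beta (k : I) :
    (forall l, is_partition_of #|B l| (beta l)) -> mx_irreducible rM ->
    irr_comp sG rM = irr_comp sG (outer_tensor n C beta) ->
  tperm_sum (B k) rM = (content_q C (beta k) *+ 2)%:M.
Proof.
move=> bP irrM eqc.
have opE d' (rG : mx_representation C Geta d') :
    gring_op rG (tperm_sum (B k) (regular_repr C Geta)) = tperm_sum (B k) rG.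
  rewrite /tperm_sum linear_sum; apply: eq_bigr => x Bx.
  rewrite linear_sum; apply: eq_bigr => y /andP[By _] /=.
  by rewrite gring_opG // (subsetP (Sym_block_sub n k)) ?tperm_Sym.
rewrite -opE; apply: (irr_comp_scalar irrM (outer_tensor_degree_gt0 beta) eqc).
rewrite opE -[LHS](@gring_op_tperm_sum _ _ _ _ _
  (subg_repr (outer_tensor n C beta) (Sym_block_sub n k)) (subxx _)).
by apply: outer_tensor_scalar; rewrite gring_op_tperm_sum // specht_tperm_sum.
Qed.

End YoungIrr.

(** * The spectrum *)

Section MultipartiteSum.

Variables (C : fieldType) (n : nat) (eta : seq nat) (d : nat).
Hypothesis etaS : sumn eta = n.
Local Notation B k := (@block n eta k).
Local Notation I := 'I_(size eta).
Variable rho : 'S_n -> 'M[C]_d.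

(** With [b] the block index, edges are the pairs with [b i != b j]. Doubling the sum over [i < j]
    counts ordered pairs from different blocks, since [tperm] is symmetric. *)
Lemma multipartite_tperm_sum :
  (\sum_(i < n) \sum_(j < n | (i < j)%N && @multipartite_edge n eta i j)
     rho (tperm i j)) *+ 2
  = tperm_sum setT rho - \sum_(k < size eta) tperm_sum (B k) rho.
Proof.
have /fin_all_exists[b bB] := block_cover etaS.
have memB k x : (x \in B k) = (b x == k).
  by apply/idP/eqP => [Bx|<- //]; apply: block_inj Bx.
have edgeE i j : @multipartite_edge n eta i j = (b i != b j).
  apply/existsP/idP => [[k /existsP[l]]|nb].
    by rewrite !memB => /and3P[nkl /eqP-> /eqP->].
  by exists (b i); apply/existsP; exists (b j); rewrite !memB nb !eqxx.
pose f i j := rho (tperm i j).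
have -> : \sum_(k < size eta) tperm_sum (B k) rho
    = \sum_i \sum_(j | (j != i) && (b j == b i)) f i j.
  rewrite [RHS](partition_big b predT) //=; apply: eq_bigr => k _.
  apply: eq_big => [i|i]; rewrite memB // => /eqP bi.
  by apply: eq_bigl => j; rewrite memB bi andbC.
have -> : tperm_sum setT rho = \sum_i \sum_(j | j != i) f i j.
  by apply: eq_big => [i|i _]; rewrite ?inE //; apply: eq_bigl => j; rewrite inE.
rewrite -sumrB mulr2n.
have splitE : \sum_(i < n) \sum_(j < n | (j != i) && (b j != b i)) f i j =
    \sum_(i < n) \sum_(j < n | (i < j)%N && (b i != b j)) f i j
    + \sum_(i < n) \sum_(j < n | (j < i)%N && (b j != b i)) f i j.
  rewrite -big_split; apply: eq_bigr => i _ /=.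
  rewrite (bigID (fun j : 'I_n => (i < j)%N)) /=; congr (_ + _).
    apply: eq_bigl => j; rewrite [b j == _]eq_sym -val_eqE /=.
    by case: ltngtP; rewrite ?andbF ?andbT.
  apply: eq_bigl => j; rewrite -val_eqE /=.
  by case: ltngtP; rewrite ?andbF ?andbT.
transitivity (\sum_i \sum_(j | (j != i) && (b j != b i)) f i j); last first.
  apply: eq_bigr => i _; rewrite [in RHS](bigID (fun j => b j == b i)) /=.
  by rewrite addrAC subrr add0r.
rewrite splitE; congr (_ + _).
  by apply: eq_bigr => i _; apply: eq_bigl => j; rewrite edgeE.
rewrite [RHS](exchange_big_dep predT) //=; apply: eq_bigr => i _.
apply: eq_big => [j|j _]; first by rewrite edgeE.
by rewrite /f tpermC.
Qed.

End MultipartiteSum.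

Lemma val_submod_tperm_sum (F : fieldType) (T : finType) (A : {set T})
    (H : {group {perm T}}) d (rG : mx_representation F H d) (U : 'M_d)
    (modU : mxmodule rG U) m (W : 'M_(m, \rank U)) :
    perm.Sym A \subset H ->
  val_submod (W *m tperm_sum A (submod_repr modU)) = val_submod W *m tperm_sum A rG.
Proof.
move=> /subsetP sAH; rewrite /tperm_sum !mulmx_sumr linear_sum.
apply: eq_bigr => x Ax; rewrite !mulmx_sumr linear_sum.
apply: eq_bigr => y /andP[Ay _] /=.
by rewrite val_submodJ // sAH ?tperm_Sym.
Qed.

(** * Eigenvalues of the graph element on the Specht module *)

Section Spectrum.

Variables (C : numClosedFieldType) (n : nat) (eta alpha : seq nat).
Hypothesis etaP : is_partition_of n eta.
Hypothesis alphaP : is_partition_of n alpha.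
Local Notation B k := (@block n eta k).
Local Notation I := 'I_(size eta).
Local Notation Geta := (young_subgroup n eta).
Local Notation G := (perm.Sym_group [set: 'I_n]).
Local Notation S := (specht_repr C [set: 'I_n] alpha).
Local Notation V := (subg_repr S (young_subgroup_sub_Sym n eta)).
Local Notation X := (gring_op S (W_graph C (@multipartite_edge n eta))).
Local Notation iG := (DecSocleType (regular_repr C Geta)).

Lemma eta_sumn : sumn eta = n.
Proof. by case/and3P: etaP => _ _ /eqP. Qed.

Lemma op_W_graph :
  X *+ 2 = (content_q C alpha *+ 2)%:M - \sum_(k < size eta) tperm_sum (B k) S.
Proof.
have alphaT : is_partition_of #|[set: 'I_n]| alpha by rewrite cardsT card_ord.
rewrite -(specht_tperm_sum C alphaT) -(multipartite_tperm_sum eta_sumn).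
congr (_ *+ 2); rewrite /W_graph linear_sum; apply: eq_bigr => i _.
rewrite linear_sum; apply: eq_bigr => j _ /=.
by rewrite gring_opG // tperm_Sym ?inE.
Qed.

(** Elements of the Young subgroup preserve each block, hence commute with each block sum. This
    makes the eigenspaces of [X] stable under that subgroup. *)
Lemma op_W_graph_comm g : g \in Geta -> X *m S g = S g *m X.
Proof.
move=> Gg; have Tg := subsetP (young_subgroup_sub_Sym n eta) g Gg.
have /young_subgroupP gB := Gg.
have two_neq0 : (2%:R : C) != 0 by rewrite pnatr_eq0.
apply: (scalerI two_neq0); rewrite scalemxAl scalemxAr !scaler_nat op_W_graph.
rewrite mulmxBl mulmxBr scalar_mxC; congr (_ - _).
rewrite mulmx_suml mulmx_sumr; apply: eq_bigr => k _.
rewrite (@tperm_sum_comm _ _ (B k) _ _ S g) //.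
apply: subset_trans (Sym_block_sub n k) _.
exact: young_subgroup_sub_Sym.
Qed.

Lemma simple_op_W_graph U (simU : mxsimple V U) (beta : I -> seq nat) :
    (forall k, is_partition_of #|B k| (beta k)) ->
    irr_comp iG (submod_repr (mxsimple_module simU))
      = irr_comp iG (outer_tensor n C beta) ->
  U *m X = (content_q C alpha - \sum_(k < size eta) content_q C (beta k)) *: U.
Proof.
move=> bP eqc; set rU := submod_repr _ in eqc.
have irrU : mx_irreducible rU by apply/submod_mx_irr.
have tU k : U *m tperm_sum (B k) S = (content_q C (beta k) *+ 2) *: U.
  (* The identity holds for the representation carried by [U]; [val_submod] brings it back to the
     ambient space. *)
  have := irr_comp_outer_tperm_sum k bP irrU eqc.
  move/(congr1 (fun M => val_submod (in_submod U U *m M))).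
  rewrite mul_mx_scalar linearZ (val_submod_tperm_sum _ _ (Sym_block_sub n k)).
  by rewrite /= in_submodK.
have two_neq0 : (2%:R : C) != 0 by rewrite pnatr_eq0.
apply: (scalerI two_neq0); rewrite scalemxAr scaler_nat op_W_graph mulmxBr.
rewrite mul_mx_scalar mulmx_sumr (eq_bigr _ (fun k _ => tU k)) -scaler_suml.
by rewrite -scalerBl scalerA mulrBr !mulr_natl sumrMnl.
Qed.

(** A nonzero eigenspace contains a simple submodule for the Young subgroup, whose type gives
    [beta]. Conversely, positive multiplicity gives an isotypic component whose simple base lies in
    the eigenspace. *)
Lemma spectrum_specht x :
  eigenvalue X x <-> exists beta : I -> seq nat, admissible C n alpha beta
    /\ x = content_q C alpha - \sum_(k < size eta) content_q C (beta k).
Proof.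
have cardB k : #|B k| = nth 0%N eta k by apply: card_block; apply: eta_sumn.
split=> [ev|[beta [[bP]]]].
  have modK : mxmodule V (eigenspace X x).
    apply: kermx_centg_module; apply/centgmxP => g Gg /=.
    by rewrite mulmxBl mulmxBr op_W_graph_comm // scalar_mxC.
  have [U simU sUK] := dec_mxsimple_exists modK ev.
  have [modU nzU _] := simU.
  have irrU : mx_irreducible (submod_repr (mxsimple_module simU)).
    by apply/submod_mx_irr.
  have [beta bP eqc] := irr_comp_outer_exists eta_sumn iG irrU.
  exists beta; split; last first.
    have /eigenspaceP := sUK; rewrite (simple_op_W_graph bP eqc) => /eqP.
    by rewrite -subr_eq0 -scalerBl scaler_eq0 (negPf nzU) orbF subr_eq0 => /eqP.
  split=> [k|]; first by rewrite -cardB.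
  (* The component [M] of the type of [U] contributes a positive multiplicity to the sum. *)
  have [M isoM] := Socle_iso (DecSocleType V) simU.
  rewrite /LR_mult /repr_mult (bigD1 M) /=.
    rewrite addn_gt0 divn_gt0.
      by rewrite mxrankS //; apply: component_mx_id; apply: socle_simple.
    by rewrite lt0n mxrank_eq0; case: (socle_simple M).
  apply/eqP; rewrite -eqc; apply: (irr_comp_rsim_pchar iG (num_pchar'_group C Geta)).
  exact/mx_rsim_iso.
rewrite /LR_mult /repr_mult lt0n sum_nat_eq0 negb_forall => /existsP[M].
rewrite negb_imply => /andP[/eqP eqc _] ->.
have bP' k : is_partition_of #|B k| (beta k) by rewrite cardB.
have simM := socle_simple M; have [_ nzM _] := simM.
rewrite /eigenvalue; apply: contraNneq nzM => K0.
have : (socle_base M <= eigenspace X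
    (content_q C alpha - \sum_(k < size eta) content_q C (beta k)))%MS.
  apply/eigenspaceP; exact: (@simple_op_W_graph _ simM beta bP' eqc).
by rewrite K0 submx0.
Qed.

End Spectrum.

Lemma rsim_eigenvalue (F : fieldType) (gT : finGroupType) (G : {group gT}) n1 n2
    (rG1 : mx_representation F G n1) (rG2 : mx_representation F G n2) z x :
  mx_rsim rG1 rG2 ->
  eigenvalue (gring_op rG1 z) x -> eigenvalue (gring_op rG2 z) x.
Proof.
case=> B _ freeB homB /eigenvalueP[v vz nzv]; apply/eigenvalueP.
exists (v *m B); last by rewrite mulmx_free_eq0.
by rewrite -mulmxA -(rsim_gring_op _ homB) mulmxA vz scalemxAl.
Qed.

Theorem theorem5p3 (C : numClosedFieldType) (n : nat) (eta alpha : seq nat)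
    (d : nat) (T : mx_representation C (perm.Sym_group [set: 'I_n]) d) :
  is_partition_of n eta -> (2 <= size eta)%N -> is_partition_of n alpha ->
  mx_rsim T (specht_repr C [set: 'I_n] alpha) ->
  forall x : C,
    eigenvalue (gring_op T (W_graph C (@multipartite_edge n eta))) x
    <->
    exists beta : 'I_(size eta) -> seq nat,
      admissible C n alpha beta
      /\ x = content_q C alpha - \sum_(k < size eta) content_q C (beta k).
Proof.
move=> etaP _ alphaP simT x.
apply: iff_trans (spectrum_specht etaP alphaP x); split.
  exact: rsim_eigenvalue.
exact: rsim_eigenvalue (mx_rsim_sym simT).
Qed.
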